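(* Let $\mathbb{P}$ be the forcing poset consisting of triples $(T,F,A)$ satisfying: (1) $T=(|T|,<_T)$ is a finite tree on $\omega_1$; (2) $F$ is an injective function from the set of maximal nodes of $T$ into $\omega_2$; (3) $A$ is a finite adequate set; (4) if $M\in A$, $a$ and $b$ are distinct maximal nodes of $T$, and $F(a),F(b)\in M$, then every $c$ which is below both $a$ and $b$ in $T$ is in $M$; ordered by $(U,G,B)\le(T,F,A)$ iff $U$ end-extends $T$, $A\subseteq B$, and whenever $a$ is maximal in $T$ there is $b$ maximal in $U$ such that $a\le_U b$ and $F(a)=G(b)$. Then $\mathbb{P}$ is $\omega_2$-c.c.
   Context: Standing assumptions and notation. Assume $2^{\omega_1}=\omega_2$ and fix a bijection $\pi:\omega_2\to H(\omega_2)$. $P_{\omega_1}(\omega_2)$ is the set of countable subsets of $\omega_2$. Assume there is a stationary set $\mathcal{Y}\subseteq P_{\omega_1}(\omega_2)$ which is thin, i.e. for all $\beta<\omega_2$ the set $\{a\cap\beta: a\in\mathcal{Y}\}$ has size at most $\omega_1$; fix such a $\mathcal{Y}$ which is moreover closed under initial segments ($a\in\mathcal{Y}$, $\beta<\omega_2$ imply $a\cap\beta\in\mathcal{Y}$). Let $\mathcal{A}$ be the structure $(H(\omega_2),\in,\pi,\mathcal{Y})$, which has definable Skolem functions (via the well-ordering induced by $\pi$). For $a\subseteq H(\omega_2)$, $Sk(a)$ is the closure of $a$ under a fixed set of definable Skolem functions for $\mathcal{A}$. Let $C$ be the (club) set of $\beta<\omega_2$ with $Sk(\beta)\cap\omega_2=\beta$,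 and let $\Lambda$ be the set of $\beta<\omega_2$ of cofinality $\omega_1$ which are limit points of $C$. Let $\mathcal{X}$ be the set of $M\in\mathcal{Y}$ such that $Sk(M)\cap\omega_2=M$ and for all $\gamma\in M$, $\sup(C\cap\gamma)\in M$. Comparison points and adequacy. Fix a set $\Gamma\subseteq\Lambda$ which is stationary in $\omega_2$. For $M\in\mathcal{X}$, $\Gamma_M$ is the set of $\beta\in\Gamma$ such that $\beta=\min(\Gamma\setminus\sup(M\cap\beta))$, i.e. $\Gamma\cap[\sup(M\cap\beta),\beta)=\emptyset$. For $M,N\in\mathcal{X}$, $\Gamma_M\cap\Gamma_N$ has a largest element, denoted $\beta_{M,N}$. A set $A\subseteq\mathcal{X}$ is adequate if for all $M,N\in A$, either $M\cap\beta_{M,N}=N\cap\beta_{M,N}$, or $M\cap\beta_{M,N}\in Sk(N)$, or $N\cap\beta_{M,N}\in Sk(M)$. Finite trees. A finite tree on $\omega_1$ is a pair $T=(|T|,<_T)$ such that $|T|$ is a finite subset of $\omega_1$; $<_T$ is an irreflexive transitive relation on $|T|$; if $a,b<_T c$ then $a=b$, $a<_T b$ or $b<_T a$; and $a<_T b$ implies $a<b$. $U$ end-extends $T$ if $|T|\subseteq|U|$ and $<_U\cap(|T|\times|T|)=\ <_T$. A poset is $\omega_2$-c.c. if every antichain has size less than $\omega_2$. *)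

(* Defs.v *)
From HB Require Import structures.
From mathcomp Require Import all_boot.
From mathcomp Require Import boolp classical_sets functions cardinality.

Set Implicit Arguments.
Unset Strict Implicit.
Unset Printing Implicit Defensive.

Local Open Scope classical_set_scope.
Local Open Scope card_scope.

(* The ambient universe of sets: well-founded trees of arbitrary branching
   (Aczel), quotiented by bisimulation so that equality is Leibniz equality.
   A [set V] is a class. *)

Inductive preset : Type := Node (I : Type) (f : I -> preset).

Fixpoint bisim (s t : preset) : Prop :=
  match s, t with
  | @Node T f, @Node U g =>
      (forall i, exists j, bisim (f i) (g j)) /\
      (forall j, exists i, bisim (f i) (g j))
  end.

Definition V : Type := {X : set preset | exists t, X = bisim t}.

HB.instance Definition _ := gen_eqMixin V.
HB.instance Definition _ := gen_choiceMixin V.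

Definition vmem (x y : V) : Prop :=
  exists I (f : I -> preset) i, sval y (Node f) /\ sval x (f i).

Declare Scope vset_scope.
Notation "x ∈ y" := (vmem x y) (at level 70, no associativity) : vset_scope.
Local Open Scope vset_scope.

Definition ext (x : V) : set V := [set y | y ∈ x].

Lemma bisim_refl t : bisim t t.
Proof. by elim: t => I f IH /=; split=> i; exists i. Qed.

Lemma bisim_sym s t : bisim s t -> bisim t s.
Proof.
elim: s t => I f IH [J g] /= [h1 h2]; split.
  by move=> j; have [i /IH] := h2 j; exists i.
by move=> i; have [j /IH] := h1 i; exists j.
Qed.

Lemma bisim_trans s t u : bisim s t -> bisim t u -> bisim s u.
Proof.
elim: s t u => I f IH [J g] [K h] /= [a1 a2] [b1 b2]; split.
  by move=> i; have [j ij] := a1 i; have [k jk] := b1 j; exists k; apply: IH jk.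
by move=> k; have [j jk] := b2 k; have [i ij] := a2 j; exists i; apply: IH jk.
Qed.

Lemma bisim_class s t : bisim s t -> bisim s = bisim t.
Proof.
move=> st; apply/funext => u; apply/propext; split; last exact: bisim_trans.
by apply: bisim_trans; apply: bisim_sym.
Qed.

Definition vcls (t : preset) : V := exist _ (bisim t) (ex_intro _ t erefl).

Lemma vcls_surj (x : V) : exists t, x = vcls t.
Proof.
by case: x => X [t Xt]; exists t; apply: eq_exist.
Qed.

Lemma vclsP s t : vcls s = vcls t <-> bisim s t.
Proof.
split=> [[->]|/bisim_class st]; first exact: bisim_refl.
exact: eq_exist.
Qed.

Lemma vmem_cls (x : V) I (f : I -> preset) :
  x ∈ vcls (Node f) <-> exists i, x = vcls (f i).
Proof.
have [t ->] := vcls_surj x; split.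
  move=> [J [g [j [/= [_ h2] tj]]]]; have [i ij] := h2 j.
  by exists i; apply/vclsP; apply: bisim_trans tj (bisim_sym ij).
move=> [i /vclsP ti]; exists I, f, i; split => //=.
by split=> k; exists k; exact: bisim_refl.
Qed.

Lemma ext_inj (x y : V) : ext x = ext y -> x = y.
Proof.
have [[I f] ->] := vcls_surj x; have [[J g] ->] := vcls_surj y => e.
have E z : z ∈ vcls (Node f) <-> z ∈ vcls (Node g).
  by have := congr1 (fun A : set V => A z) e; rewrite /ext /= => ->.
apply/vclsP; split=> [i|j].
  have /vmem_cls[j /vclsP] : vcls (f i) ∈ vcls (Node g).
    by apply/E/vmem_cls; exists i.
  by exists j.
have /vmem_cls[i /vclsP] : vcls (g j) ∈ vcls (Node f).
  by apply/E/vmem_cls; exists j.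
by move=> /bisim_sym; exists i.
Qed.

Lemma vmem_ind (P : V -> Prop) :
  (forall x, (forall y, y ∈ x -> P y) -> P x) -> forall x, P x.
Proof.
move=> IH x; have [t ->] := vcls_surj x; elim: t => I f IHf.
by apply: IH => y /vmem_cls[i ->].
Qed.

Definition vempty : V := vcls (Node (fun e : Empty_set => match e with end)).

(* The set with extension [A]; the junk value [vempty] if [A] is a proper
   class. *)
Definition code (A : set V) : V := xget vempty [set x | ext x = A].

Lemma ext_code (A : set V) (I : Type) (f : I -> V) :
  A `<=` range f -> ext (code A) = A.
Proof.
move=> Af; apply: (@xgetPex _ vempty [set x | ext x = A]).
have [g gE] := choice (fun i => vcls_surj (f i)).
exists (vcls (Node (fun i : {i | A (f i)} => g (sval i)))).
apply/seteqP; split=> y /=.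
  by move=> /vmem_cls[[i Ai] /= ->]; rewrite -gE.
move=> Ay; have [i _ fi] := Af _ Ay; apply/vmem_cls.
by rewrite -fi in Ay *; exists (exist _ i Ay); rewrite gE.
Qed.

Lemma ext_code_sub (A : set V) (x : V) : A `<=` ext x -> ext (code A) = A.
Proof.
have [[I f] ->] := vcls_surj x => Ax.
apply: (@ext_code _ I (vcls \o f)) => y /Ax /vmem_cls[i ->]; by exists i.
Qed.

Definition vinter (x y : V) : V := code (ext x `&` ext y).

Definition card_lt T U (A : set T) (B : set U) : Prop :=
  A #<= B /\ ~~ (B #<= A).

Definition transitive_set (x : V) : Prop := forall y, y ∈ x -> ext y `<=` ext x.

Definition ordinal (a : V) : Prop :=
  transitive_set a /\
  (forall x y, x ∈ a -> y ∈ a -> x ∈ y \/ x = y \/ y ∈ x).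

Definition ole (a b : V) : Prop := a ∈ b \/ a = b.

(* [omega1] is the set of all countable ordinals, [omega2] the set of all
   ordinals of size at most [omega1]. *)
Definition omega1 : set V := [set a | ordinal a /\ countable (ext a)].
Definition omega2 : set V := [set a | ordinal a /\ ext a #<= omega1].

(* On sets of ordinals the supremum is the union; [osup set0] is zero. *)
Definition osup (A : set V) : V := code (\bigcup_(a in A) ext a).

Definition is_min (A : set V) (b : V) : Prop := A b /\ forall a, A a -> ole b a.
Definition is_max (A : set V) (b : V) : Prop := A b /\ forall a, A a -> ole a b.

Definition limit_point (A : set V) (b : V) : Prop :=
  b <> vempty /\ forall c, c ∈ b -> exists d, [/\ A d, d ∈ b & c ∈ d].

Definition cofinal_in (X : set V) (b : V) : Prop :=
  X `<=` ext b /\ forall c, c ∈ b -> exists2 d, X d & ole c d.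

(* cf(b) = |K|: the least size of a cofinal subset of b is |K|. *)
Definition has_cofinality (b : V) (K : set V) : Prop :=
  (exists2 X, cofinal_in X b & X #= K) /\
  (forall X, cofinal_in X b -> K #<= X).

Definition club_omega2 (D : set V) : Prop :=
  [/\ D `<=` omega2,
      forall a, omega2 a -> exists2 d, D d & a ∈ d &
      forall b, omega2 b -> limit_point D b -> D b].

Definition stationary_omega2 (S : set V) : Prop :=
  S `<=` omega2 /\ forall D, club_omega2 D -> D `&` S !=set0.

Definition P_omega1_omega2 : set V :=
  [set a | ext a `<=` omega2 /\ countable (ext a)].

Definition club_P_omega1 (D : set V) : Prop :=
  [/\ D `<=` P_omega1_omega2,
      forall a, P_omega1_omega2 a -> exists2 d, D d & ext a `<=` ext d &
      forall f : nat -> V, (forall n, D (f n)) ->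
        (forall n, ext (f n) `<=` ext (f n.+1)) ->
        D (code (\bigcup_n ext (f n)))].

Definition stationary_P_omega1 (S : set V) : Prop :=
  S `<=` P_omega1_omega2 /\ forall D, club_P_omega1 D -> D `&` S !=set0.

Definition thin (Y : set V) : Prop :=
  forall b, omega2 b -> [set vinter a b | a in Y] #<= omega1.

Definition closed_initial_segments (Y : set V) : Prop :=
  forall a b, Y a -> omega2 b -> Y (vinter a b).

Inductive trcl (x : V) : V -> Prop :=
| trcl_mem y : y ∈ x -> trcl x y
| trcl_trans y z : trcl x y -> z ∈ y -> trcl x z.

Definition H_omega2 : set V := [set x | card_lt (trcl x) omega2].

(* [formula n]: formulas with free variables among 0, ..., n.-1 (de Bruijn
   indices).  [FPi i j] is the graph of the partial function pi. *)
Inductive formula : nat -> Type :=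
| FEq n (i j : 'I_n) : formula n
| FMem n (i j : 'I_n) : formula n
| FPi n (i j : 'I_n) : formula n
| FY n (i : 'I_n) : formula n
| FNot n (p : formula n) : formula n
| FAnd n (p q : formula n) : formula n
| FEx n (p : formula n.+1) : formula n.

Definition tcons n (x : V) (e : n.-tuple V) : n.+1.-tuple V := [tuple of x :: e].

(* Satisfaction in (H(omega_2), ∈, pi, Y). *)
Fixpoint sat (pi : V -> V) (Y : set V) n (p : formula n) :
    n.-tuple V -> Prop :=
  match p in formula n return n.-tuple V -> Prop with
  | @FEq n i j => fun e => tnth e i = tnth e j
  | @FMem n i j => fun e => tnth e i ∈ tnth e j
  | @FPi n i j => fun e => omega2 (tnth e i) /\ pi (tnth e i) = tnth e j
  | @FY n i => fun e => Y (tnth e i)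
  | @FNot n p => fun e => ~ sat pi Y p e
  | @FAnd n p q => fun e => sat pi Y p e /\ sat pi Y q e
  | @FEx n p => fun e => exists2 x, H_omega2 x & sat pi Y p (tcons x e)
  end.

Definition H_tuple n (e : n.-tuple V) : Prop := forall i, H_omega2 (tnth e i).

Definition definable_fun (pi : V -> V) (Y : set V) n (f : n.-tuple V -> V) :
    Prop :=
  (forall e, H_tuple e -> H_omega2 (f e)) /\
  exists p : formula n.+1, forall e x, H_tuple e -> H_omega2 x ->
    (sat pi Y p (tcons x e) <-> x = f e).

Definition fun_family : Type := forall n, set (n.-tuple V -> V).

(* A family of parameter-free definable functions (of all arities, constants
   included) containing a Skolem function for every formula; index 0 of a
   formula is the witness, indices 1, ..., n the arguments. *)
Definition definable_skolem_functions (pi : V -> V) (Y : set V)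
    (SF : fun_family) : Prop :=
  (forall n f, SF n f -> definable_fun pi Y f) /\
  (forall n (p : formula n.+1), exists2 f, SF n f &
    forall e, H_tuple e ->
      (exists2 x, H_omega2 x & sat pi Y p (tcons x e)) ->
      sat pi Y p (tcons (f e) e)).

Inductive Sk (SF : fun_family) (a : set V) : V -> Prop :=
| Sk_base x : a x -> Sk SF a x
| Sk_app n f (e : n.-tuple V) :
    SF n f -> (forall i, Sk SF a (tnth e i)) -> Sk SF a (f e).

Definition Cset (SF : fun_family) : set V :=
  [set b | omega2 b /\ Sk SF (ext b) `&` omega2 = ext b].

Definition Lambda (SF : fun_family) : set V :=
  [set b | [/\ omega2 b, has_cofinality b omega1 & limit_point (Cset SF) b]].

Definition Xset (Y : set V) (SF : fun_family) : set V :=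
  [set M | [/\ Y M, Sk SF (ext M) `&` omega2 = ext M &
    forall c, c ∈ M -> osup (Cset SF `&` ext c) ∈ M]].

Definition Gamma_at (Gamma : set V) (M : V) : set V :=
  [set b | Gamma b /\ is_min (Gamma `\` ext (osup (ext (vinter M b)))) b].

(* The largest element of the intersection, by definite description. *)
Definition beta_cmp (Gamma : set V) (M N : V) : V :=
  xget vempty (is_max (Gamma_at Gamma M `&` Gamma_at Gamma N)).

Definition adequate (Y : set V) (SF : fun_family) (Gamma A : set V) : Prop :=
  A `<=` Xset Y SF /\
  forall M N, A M -> A N ->
    let b := beta_cmp Gamma M N in
    [\/ vinter M b = vinter N b,
        Sk SF (ext N) (vinter M b) |
        Sk SF (ext M) (vinter N b)].

Record finite_tree : Type := FiniteTree {
  node : set V;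
  tlt : V -> V -> Prop;
  _ : node `<=` omega1;
  _ : finite_set node;
  _ : forall a b, tlt a b -> node a /\ node b;
  _ : forall a, ~ tlt a a;
  _ : forall a b c, tlt a b -> tlt b c -> tlt a c;
  _ : forall a b c, tlt a c -> tlt b c -> [\/ a = b, tlt a b | tlt b a];
  _ : forall a b, tlt a b -> a ∈ b }.

Definition tle (T : finite_tree) (a b : V) : Prop := tlt T a b \/ a = b.

Definition maximal_node (T : finite_tree) : set V :=
  [set a | node T a /\ forall b, ~ tlt T a b].

Definition end_extends (U T : finite_tree) : Prop :=
  node T `<=` node U /\
  forall a b, node T a -> node T b -> (tlt U a b <-> tlt T a b).

Record condition (Y : set V) (SF : fun_family) (Gamma : set V) : Type :=
  Condition {
  ctree : finite_tree;
  cfun : maximal_node ctree -> omega2;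
  cside : set V;
  _ : injective cfun;
  _ : finite_set cside;
  _ : adequate Y SF Gamma cside;
  _ : forall (M : V) (a b : maximal_node ctree), cside M -> a <> b ->
        set_val (cfun a) ∈ M -> set_val (cfun b) ∈ M ->
        forall c, tlt ctree c (set_val a) -> tlt ctree c (set_val b) ->
          c ∈ M }.

Arguments cfun {Y SF Gamma} c a : rename.

Definition cond_le Y SF Gamma (q p : condition Y SF Gamma) : Prop :=
  [/\ end_extends (ctree q) (ctree p),
      cside p `<=` cside q &
      forall a : maximal_node (ctree p), exists b : maximal_node (ctree q),
        tle (ctree q) (set_val a) (set_val b) /\ cfun p a = cfun q b].

Definition antichain (P : Type) (le : P -> P -> Prop) (A : set P) : Prop :=
  forall p q, A p -> A q -> p <> q -> ~ exists r, le r p /\ le r q.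

Definition chain_condition (P : Type) (le : P -> P -> Prop) (K : set V) :
    Prop :=
  forall A : set P, antichain le A -> card_lt A K.

(* Main.v *)
From HB Require Import structures.
From mathcomp Require Import all_boot.
From mathcomp Require Import boolp classical_sets functions cardinality.
Require Import Defs.

Set Implicit Arguments.
Unset Strict Implicit.
Unset Printing Implicit Defensive.

Local Open Scope classical_set_scope.
Local Open Scope card_scope.
Local Open Scope vset_scope.

(* The proof is by reflection. A condition q has a trace below an ordinal g:
   its tree, the labels below g and the initial segments N ∩ g of its models; by
   thinness there are only omega1 many traces below each g < omega2. Choose b in
   Gamma closed under a function bounding, for each g, a witness for every trace
   below g that is realized with a gap above g. If q is in the antichain, then
   cf(b) = omega1 provides g < b with every model and label of q avoiding [g, b),
   so some p in the antichain with all its entries below b has the same trace and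
   avoids [g, b') for some b' in Gamma between g and b. Such p and q are
   compatible: every maximal node is prolonged by one new node for each of its
   labels, and for M in A_p and N in A_q the comparison point of M and N is at
   most b', where N agrees with a model of A_p. Hence p = q, so q lies below b
   and is determined by its trace there. *)

(** * Sets of ordinals *)

HB.instance Definition _ := isPointed.Build V vempty.

Lemma inj_card_leE T U (A : set T) (B : set U) (f : T -> U) :
  (forall x, A x -> B (f x)) -> {in A &, injective f} -> A #<= B.
Proof.
move=> AB fI; apply: (@card_le_trans _ _ _ (f @` A)).
  by have /card_eqPle[] := inj_card_eq fI.
by apply: subset_card_le => _ [x Ax <-]; exact: AB.
Qed.

Lemma card_le_inj T (U : pointedType) (A : set T) (B : set U) :
  A #<= B ->
  exists f : T -> U, (forall x, A x -> B (f x)) /\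
    (forall x y, A x -> A y -> f x = f y -> x = y).
Proof.
move=> /pcard_leP[f]; exists f; split; first by move=> x Ax; exact: funS.
by move=> x y Ax Ay /(inj (mem_set Ax) (mem_set Ay)).
Qed.

(** Since [code] returns a junk value on a proper class, this says that the class A is a set. *)
Definition small (A : set V) : Prop := ext (code A) = A.

Lemma small_sub (A B : set V) : A `<=` B -> small B -> small A.
Proof. by move=> AB sB; apply: (@ext_code_sub _ (code B)); rewrite sB. Qed.

Lemma small_ext (x : V) : small (ext x).
Proof. exact: (@ext_code_sub _ x). Qed.

Lemma smallP (A : set V) : small A -> exists (I : Type) (f : I -> V), A = range f.
Proof.
have [[I f] e] := vcls_surj (code A) => sA; exists I, (vcls \o f); rewrite -sA e.
apply/seteqP; split=> y /=; rewrite /ext/= vmem_cls.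
  by move=> [i ->]; exists i.
by move=> [i _ <-]; exists i.
Qed.

(** Replacement and union in one: every value gets a representing tree by choice, and the pairs of
    an index and a branch of its tree index the union. *)
Lemma small_bigcup (A : set V) (F : V -> set V) :
  small A -> (forall x, A x -> small (F x)) -> small (\bigcup_(x in A) F x).
Proof.
move=> /smallP[I [f ->]] sF.
have /choice[g gE] (i : I) : exists t : V, ext t = F (f i).
  by exists (code (F (f i))); apply: sF; exists i.
have /choice[h hE] (i : I) : exists t, g i = vcls t by exact: vcls_surj.
pose dom t := let: Node J _ := t in J.
pose fam t : dom t -> V := match t with Node J k => vcls \o k end.
have famE : forall t, range (@fam t) = ext (vcls t).
  move=> t; destruct t as [J k].
  apply/seteqP; split=> y /=; rewrite /ext/= vmem_cls.
    by move=> [j _ <-]; exists j.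
  by move=> [j ->]; exists j.
apply: (@ext_code _ {i : I & dom (h i)} (fun p => fam _ (projT2 p))).
move=> y [_ [i _ <-]]; rewrite -gE hE -famE => -[j _ <-].
by exists (existT _ i j).
Qed.

Lemma small_set2 (x y : V) : small [set x; y].
Proof.
apply: (@ext_code _ bool (fun b => if b then x else y)).
by move=> z [->|->]; [exists true|exists false].
Qed.

Lemma small_setU (A B : set V) : small A -> small B -> small (A `|` B).
Proof.
move=> sA sB; apply: (@small_sub _ (\bigcup_(z in [set code A; code B]) ext z)).
  move=> x [Ax|Bx]; [exists (code A); first by left|exists (code B); first by right].
    by rewrite sA.
  by rewrite sB.
by apply: small_bigcup => [|*]; [exact: small_set2|exact: small_ext].
Qed.

Lemma mem_codeE (A : set V) (x : V) : small A -> x ∈ code A <-> A x.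
Proof. by move=> sA; rewrite -[x in A x]/(id x) -{2}sA. Qed.

Lemma in_vinter (x y z : V) : z ∈ vinter x y <-> z ∈ x /\ z ∈ y.
Proof.
rewrite /vinter mem_codeE //.
by apply: (@small_sub _ (ext x)); [move=> ? []|exact: small_ext].
Qed.

Lemma ext_eq (x y : V) : (forall z, z ∈ x <-> z ∈ y) -> x = y.
Proof. by move=> xy; apply: ext_inj; apply/seteqP; split=> z /xy. Qed.

Lemma notin_vempty (x : V) : ~ x ∈ vempty.
Proof. by rewrite /vempty vmem_cls => -[]. Qed.

Lemma vmem_min (A : set V) (x : V) : A x ->
  exists2 m, A m & forall y, y ∈ m -> ~ A y.
Proof.
move=> Ax; apply: contrapT => no; suff: forall z, ~ A z by move=> /(_ x).
apply: vmem_ind => z IH Az; apply: no; exists z => // y /IH; exact.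
Qed.

Lemma vmem_irr (x : V) : ~ x ∈ x.
Proof. by move: x; apply: vmem_ind => x IH xx; exact: (IH x xx xx). Qed.

Lemma vmem_asym (x y : V) : x ∈ y -> ~ y ∈ x.
Proof.
by move: x y; apply: vmem_ind => x IH y xy yx; exact: (IH y yx x yx xy).
Qed.

Lemma vmem_cyc3 (x y z : V) : x ∈ y -> y ∈ z -> ~ z ∈ x.
Proof.
move: x y z; apply: vmem_ind => x IH y z xy yz zx.
exact: (IH z zx x y zx xy yz).
Qed.

Lemma ord_trans (a x y : V) : ordinal a -> y ∈ x -> x ∈ a -> y ∈ a.
Proof. by move=> [t _] yx xa; exact: t xa _ yx. Qed.

Lemma ord_mem (a x : V) : ordinal a -> x ∈ a -> ordinal x.
Proof.
move=> oa xa; have t := ord_trans oa; split; last first.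
  by move=> y z yx zx; apply: oa.2; apply: t; eassumption.
move=> y yx z zy; have [//|[zx|xz]] := oa.2 z x (t _ _ zy (t _ _ yx xa)) xa.
  by subst z; case: (vmem_asym yx zy).
by case: (vmem_cyc3 xz zy yx).
Qed.

Lemma ord_tri (a b : V) : ordinal a -> ordinal b -> [\/ a ∈ b, a = b | b ∈ a].
Proof.
move: a b; apply: vmem_ind => a IHa; apply: vmem_ind => b IHb oa ob.
have [ab|nab] := pselect (a ∈ b); first exact: Or31.
have [ba|nba] := pselect (b ∈ a); first exact: Or33.
apply: Or32; apply: ext_eq => x; split=> xI.
  have [//|e|bx] := IHa _ xI b (ord_mem oa xI) ob; first by subst x.
  by case: nba; exact: ord_trans xI.
have [ax|e|//] := IHb _ xI oa (ord_mem ob xI); last by subst x.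
by case: nab; exact: ord_trans xI.
Qed.

Lemma oleP (a b : V) : ordinal a -> ordinal b -> ole a b <-> ext a `<=` ext b.
Proof.
move=> oa ob; split=> [[ab|->//] x xa|ab]; first exact: ord_trans xa ab.
have [|->|/ab bb] := ord_tri oa ob; [by left|by right|].
by case: (vmem_irr bb).
Qed.

Lemma oleNgt (a b : V) : ordinal a -> ordinal b -> ole a b <-> ~ b ∈ a.
Proof.
move=> oa ob; split=> [[ab|->]|ba]; [exact: vmem_asym|exact: vmem_irr|].
by have [|->|//] := ord_tri oa ob; [left|right].
Qed.

Lemma ole_lt_trans (a b c : V) : ordinal c -> ole a b -> b ∈ c -> a ∈ c.
Proof. by move=> oc [ab bc|->//]; exact: ord_trans ab bc. Qed.

Lemma lt_ole_trans (a b c : V) : ordinal c -> a ∈ b -> ole b c -> a ∈ c.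
Proof. by move=> oc ab [bc|<-//]; exact: ord_trans ab bc. Qed.

Lemma ord_transitive_set (A : set V) (a : V) :
  ext a = A -> (forall x, A x -> ordinal x) ->
  (forall x y, A x -> y ∈ x -> A y) -> ordinal a.
Proof.
move=> <- oA tA; split=> [x xa y yx|x y xa ya]; first exact: tA xa yx.
by have [] := ord_tri (oA _ xa) (oA _ ya); tauto.
Qed.

Lemma ord_min (A : set V) (a : V) : A a -> (forall x, A x -> ordinal x) ->
  exists m, is_min A m.
Proof.
move=> Aa oA; have [m Am mA] := vmem_min Aa; exists m; split=> // x Ax.
by apply/oleNgt; [exact: oA|exact: oA|move=> /mA].
Qed.

Definition vsucc (x : V) : V := code (ext x `|` [set x; x]).

Lemma in_vsucc (x y : V) : y ∈ vsucc x <-> y ∈ x \/ y = x.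
Proof.
rewrite /vsucc mem_codeE; last first.
  by apply: small_setU; [exact: small_ext|exact: small_set2].
by split=> -[|]; [left|case; right|left|right; left].
Qed.

Lemma ord_vsucc (a : V) : ordinal a -> ordinal (vsucc a).
Proof.
move=> oa; apply: (@ord_transitive_set _ _ erefl) => [x|x y]; rewrite /ext/=.
  by rewrite in_vsucc => -[/(ord_mem oa)|->].
by rewrite !in_vsucc => -[xa yx|-> ya]; left=> //; exact: ord_trans xa.
Qed.

Lemma ord_osup (A : set V) : small A -> (forall x, A x -> ordinal x) ->
  ordinal (osup A) /\ forall y, y ∈ osup A <-> exists2 x, A x & y ∈ x.
Proof.
move=> sA oA; have sU : small (\bigcup_(x in A) ext x).
  by apply: small_bigcup => // x _; exact: small_ext.
have E y : y ∈ osup A <-> exists2 x, A x & y ∈ x by rewrite mem_codeE.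
split=> //; apply: (@ord_transitive_set _ _ sU) => [x [a Aa xa]|x y [a Aa xa] yx].
  exact: ord_mem (oA _ Aa) xa.
by exists a => //; apply: ord_trans xa => //; exact: oA.
Qed.

(** * Hartogs ordinals; [omega1] and [omega2] are sets *)

Definition Hartogs (K : set V) : set V := [set a | ordinal a /\ ext a #<= K].

(* An ordinal embedded in [w] is determined by the image of the embedding
   together with the transported membership relation, and there is only a set
   of such data. *)
Lemma small_Hartogs (w : V) : small (Hartogs (ext w)).
Proof.
have [[I f] ->] := vcls_surj w.
pose R (j : (I -> Prop) * (I -> I -> Prop)) a (h : V -> V) :=
  [/\ forall x, x ∈ a -> exists i, h x = vcls (f i),
      forall i, j.1 i <-> exists2 x, x ∈ a & h x = vcls (f i),
      forall i i', j.2 i i' <-> exists x x', [/\ x ∈ a, x' ∈ a, x ∈ x',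
        h x = vcls (f i) & h x' = vcls (f i')],
      forall x y, x ∈ a -> y ∈ a -> h x = h y -> x = y & ordinal a].
(* Two ordinals with the same data: points with equal images are equal, by ∈-induction, since the
   transported relation matches their elements. *)
have key j a b h k : R j a h -> R j b k ->
    forall x y, x ∈ a -> y ∈ b -> h x = k y -> x = y.
  move=> [ha _ Ra Ia oa] [kb _ Rb Ib ob].
  apply: vmem_ind => x IH y xa yb hk; apply: ext_eq => z; split.
    move=> zx; have za := ord_trans oa zx xa.
    have [[i hi] [i' hi']] := (ha _ za, ha _ xa).
    have /Rb[z' [y' [z'b y'b zy' kz' ky']]] : j.2 i i' by apply/Ra; exists z, x.
    have ey : y' = y by apply: Ib; rewrite // ky' -hi'.
    by rewrite (IH _ zx z') // -?ey // hi kz'.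
  move=> zy; have zb := ord_trans ob zy yb.
  have [[i hi] [i' hi']] := (kb _ zb, kb _ yb).
  have /Ra[z' [x' [z'a x'a zx' hz' hx']]] : j.2 i i' by apply/Rb; exists z, y.
  have ex : x' = x by apply: Ia; rewrite // hx' -hi'.
  by rewrite -(IH z' _ z) -?ex ?hz' //; rewrite -ex.
have uniq j a b h k : R j a h -> R j b k -> a = b.
  move=> Ra Rb; have K := key _ _ _ _ _ Ra Rb.
  have [ha Da _ _ _] := Ra; have [kb Db _ _ _] := Rb.
  apply: ext_eq => x; split=> xI.
    have [i hi] := ha _ xI; have /Db[y yb ky] : j.1 i by apply/Da; exists x.
    by rewrite (K x y) // hi ky.
  have [i hi] := kb _ xI; have /Da[y yb ky] : j.1 i by apply/Db; exists x.
  by rewrite -(K y x) // hi ky.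
pose F j := xget vempty [set a | exists h, R j a h].
apply: (@ext_code _ _ F) => a [oa /card_le_inj[h [hw hI]]].
pose j : (I -> Prop) * (I -> I -> Prop) :=
  (fun i => exists2 x, x ∈ a & h x = vcls (f i),
   fun i i' => exists x x', [/\ x ∈ a, x' ∈ a, x ∈ x',
        h x = vcls (f i) & h x' = vcls (f i')]).
have Rj : R j a h by split=> // x /hw /vmem_cls.
exists j => //; have [k Rk] : exists k, R j (F j) k.
  by apply: (@xgetPex _ vempty [set a | exists h, R j a h]); exists a, h.
exact: uniq Rk Rj.
Qed.

Lemma Hartogs_ordinal (w : V) : ordinal (code (Hartogs (ext w))).
Proof.
apply: (ord_transitive_set (small_Hartogs w)) => [x []//|x y [ox xw] yx].
split; first exact: ord_mem ox yx.
by apply: card_le_trans xw; apply: subset_card_le => z zy; exact: ord_trans zy yx.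
Qed.

(** Burali-Forti: otherwise the ordinal [code (Hartogs (ext w))] would be a member of itself. *)
Lemma Hartogs_not_le (w : V) : ~ (Hartogs (ext w) #<= ext w).
Proof.
move=> le; have : Hartogs (ext w) (code (Hartogs (ext w))).
  by split; [exact: Hartogs_ordinal|rewrite small_Hartogs].
by rewrite -{1}small_Hartogs => /vmem_irr.
Qed.

Definition vnat (n : nat) : V := iter n vsucc vempty.

Lemma ord_vempty : ordinal vempty.
Proof. by split=> [x|x y] /notin_vempty. Qed.

Lemma iter_vsucc_lt (a : V) m n : ordinal a -> (m < n)%N ->
  iter m vsucc a ∈ iter n vsucc a.
Proof.
move=> oa; elim: n => // n IH; rewrite ltnS leq_eqVlt => /orP[/eqP->|/IH mn];
  rewrite iterS in_vsucc; [by right|by left].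
Qed.

Lemma iter_vsucc_inj (a : V) : ordinal a -> injective (fun n => iter n vsucc a).
Proof.
move=> oa m n /= e; have [/(iter_vsucc_lt oa)|/(iter_vsucc_lt oa)|//] := ltngtP m n;
  by rewrite e => /vmem_irr.
Qed.

Definition vomega : V := code (range vnat).

Lemma ext_vomega : ext vomega = range vnat.
Proof. by apply: (@ext_code _ nat vnat). Qed.

Lemma card_vomega : ext vomega #= [set: nat].
Proof.
rewrite ext_vomega; apply: inj_card_eq => m n _ _.
exact: iter_vsucc_inj ord_vempty _ _.
Qed.

Lemma omega1_Hartogs : omega1 = Hartogs (ext vomega).
Proof.
apply/seteqP; split=> a [oa ca]; split=> //.
  by apply: card_le_trans ca _; have /card_eqPle[] := card_vomega.
by apply: card_le_trans ca _; have /card_eqPle[] := card_vomega.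
Qed.

Definition vomega1 : V := code omega1.

Lemma small_omega1 : small omega1.
Proof. by rewrite omega1_Hartogs; exact: small_Hartogs. Qed.

Lemma omega1_uncountable : ~ countable omega1.
Proof.
move=> c; apply: (@Hartogs_not_le vomega); rewrite -omega1_Hartogs.
by apply: card_le_trans c _; have /card_eqPle[] := card_vomega.
Qed.

Lemma omega2_Hartogs : omega2 = Hartogs (ext vomega1).
Proof. by rewrite /vomega1 small_omega1. Qed.

Lemma small_omega2 : small omega2.
Proof. by rewrite omega2_Hartogs; exact: small_Hartogs. Qed.

Lemma omega2_not_le : ~ (omega2 #<= omega1).
Proof. by rewrite omega2_Hartogs -{1}small_omega1; exact: Hartogs_not_le. Qed.

Lemma omega2_ord a : omega2 a -> ordinal a.
Proof. by case. Qed.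
#[global] Hint Resolve omega2_ord : core.

Lemma omega2_mem a x : omega2 a -> x ∈ a -> omega2 x.
Proof.
move=> [oa le] xa; split; first exact: ord_mem oa xa.
by apply: card_le_trans le; apply: subset_card_le => y yx; exact: ord_trans yx xa.
Qed.

Lemma omega1_mem a x : omega1 a -> x ∈ a -> omega1 x.
Proof.
move=> [oa le] xa; split; first exact: ord_mem oa xa.
by apply: card_le_trans le; apply: subset_card_le => y yx; exact: ord_trans yx xa.
Qed.

(** * Cardinal arithmetic at omega1 and omega2 *)

Lemma ext_vsucc (a : V) : ext (vsucc a) = \bigcup_b (if b then ext a else [set a]).
Proof.
apply/seteqP; split=> x; rewrite /ext/= in_vsucc.
  by move=> [xa|->]; [exists true|exists false].
by move=> [[] _ /=]; [left|right].
Qed.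

Lemma omega1_vsucc (a : V) : omega1 a -> omega1 (vsucc a).
Proof.
move=> [oa ca]; split; first exact: ord_vsucc.
rewrite ext_vsucc; apply: bigcup_countable => // -[] _ //; exact: countable1.
Qed.

(** Regularity of [omega1]: the supremum of X is a countable union of countable ordinals, and its
    successor is a strict bound. *)
Lemma omega1_bounded (X : set V) : X `<=` omega1 -> countable X ->
  exists2 d, omega1 d & forall x, X x -> x ∈ d.
Proof.
move=> X1 cX; have oX x : X x -> ordinal x by move=> /X1[].
have sX : small X by apply: small_sub X1 small_omega1.
have [oS SE] := ord_osup sX oX; exists (vsucc (osup X)).
  apply: omega1_vsucc; split=> //.
  have -> : ext (osup X) = \bigcup_(x in X) ext x by apply/seteqP; split=> y /SE.
  by apply: bigcup_countable => // x /X1[].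
move=> x Xx; rewrite in_vsucc; apply/oleP => //; first exact: oX.
by move=> y yx; apply/SE; exists x.
Qed.

Lemma vmem_wf : well_founded vmem.
Proof. by apply: vmem_ind => x IH; constructor. Qed.

Lemma omega1_iter_vsucc n (a : V) : omega1 a -> omega1 (iter n vsucc a).
Proof. by move=> oa; elim: n => // n; exact: omega1_vsucc. Qed.

(** A substitute for the map from a to ω·a: the blocks of finite successors of the values f a are
    pairwise disjoint. Recursion on ∈ picks f a as some countable ordinal above all earlier
    blocks. *)
Lemma sparse_embedding : exists f : V -> V, forall a, omega1 a ->
  omega1 (f a) /\ forall b n, b ∈ a -> iter n vsucc (f b) ∈ f a.
Proof.
pose above a (g : forall b, b ∈ a -> V) : set V :=
  [set d | omega1 d /\ forall b (h : b ∈ a) n, iter n vsucc (g b h) ∈ d].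
pose f := Fix vmem_wf (fun=> V) (fun a g => xget vempty (above a g)).
have fE a : f a = xget vempty (above a (fun b _ => f b)).
  apply: Fix_eq => x g h gh; congr xget; congr above.
  by apply/functional_extensionality_dep => y; apply/funext.
exists f; apply: vmem_ind => a IH oa.
have oI b n : b ∈ a -> omega1 (iter n vsucc (f b)).
  by move=> ba; apply: omega1_iter_vsucc; apply: (IH b ba _).1; exact: omega1_mem ba.
have : above a (fun b _ => f b) (f a); last first.
  by move=> [oF H]; split=> // b n ba; exact: H.
rewrite fE; apply: xgetPex.
have [] := @omega1_bounded (\bigcup_(b in ext a) range (fun n => iter n vsucc (f b))).
- by move=> _ [b ba [n _ <-]]; exact: oI.
- apply: bigcup_countable => [|b _]; first by case: oa.
  by apply: card_le_trans (card_image_le _ _) _.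
move=> d od H; exists d; split=> // b ba n; apply: H; exists b => //; by exists n.
Qed.

Lemma omega1X_nat : omega1 `*` [set: nat] #<= omega1.
Proof.
have [f fP] := sparse_embedding.
have lt a b m n : omega1 b -> a ∈ b -> iter m vsucc (f a) ∈ iter n vsucc (f b).
  move=> ob ab; have [[oF _] /(_ a m ab) ltf] := fP _ ob.
  by case: n => // n; apply: (ord_trans _ ltf (iter_vsucc_lt oF (ltn0Sn n)));
    exact: (omega1_iter_vsucc n.+1 (fP _ ob).1).1.
apply: (inj_card_leE (f := fun p => iter p.2 vsucc (f p.1))).
  by move=> [a n] [/= oa _]; apply: omega1_iter_vsucc; exact: (fP a oa).1.
move=> [a m] [b n] /set_mem[/= oa _] /set_mem[/= ob _] e.
have [ab|ab|ba] := ord_tri oa.1 ob.1.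
- by have := lt _ _ m n ob ab; rewrite e => /vmem_irr.
- by subst b; rewrite (iter_vsucc_inj (fP a oa).1.1 e).
- by have := lt _ _ n m oa ba; rewrite e => /vmem_irr.
Qed.

(** Code x by one index a with x in F a, together with the number of x under an injection of F a
    into the naturals. *)
Lemma le1_bigcup_countable T (F : V -> set T) :
  (forall a, omega1 a -> countable (F a)) -> \bigcup_(a in omega1) F a #<= omega1.
Proof.
move=> cF; apply: card_le_trans omega1X_nat.
have /choice[e eP] (a : V) : exists e : T -> nat,
    omega1 a -> forall x y, F a x -> F a y -> e x = e y -> x = y.
  have [/cF/card_le_inj[e [_ eI]]|] := pselect (omega1 a); last by exists (fun=> 0).
  by exists e.
have /choice[r rP] (x : T) : exists a, (\bigcup_(a in omega1) F a) x ->
    omega1 a /\ F a x.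
  have [[a oa Fx]|] := pselect ((\bigcup_(a in omega1) F a) x); first by exists a.
  by exists vempty.
apply: (inj_card_leE (f := fun x => (r x, e (r x) x))).
  by move=> x /rP[ox _].
move=> x y /set_mem/rP[ox Fx] /set_mem/rP[oy Fy] [rxy]; rewrite -rxy.
by apply: eP => //; rewrite rxy.
Qed.

(** Every pair of countable ordinals lies in the square of a single countable ordinal, and such a
    square is countable. *)
Lemma le1_omega1X : omega1 `*` omega1 #<= omega1.
Proof.
apply: card_le_trans (le1_bigcup_countable (F := fun c => ext c `*` ext c) _).
  apply: subset_card_le => -[a b] [/= oa ob].
  have [||c oc cP] := @omega1_bounded [set a; b].
  - by move=> _ [->|->].
  - exact/finite_set_countable/finite_set2.
  by exists c => //; split; apply: cP; [left|right].
by move=> c [_ cc]; exact: countableX.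
Qed.

Lemma le1X T U (A : set T) (B : set U) :
  A #<= omega1 -> B #<= omega1 -> A `*` B #<= omega1.
Proof.
move=> /card_le_inj[f [fA fI]] /card_le_inj[g [gB gI]].
apply: card_le_trans le1_omega1X.
apply: (inj_card_leE (f := fun p => (f p.1, g p.2))).
  by move=> [x y] [/fA + /gB].
move=> [x y] [x' y'] /set_mem[/= Ax By] /set_mem[/= Ax' By'] [fe ge].
by rewrite (fI x x') // (gI y y').
Qed.

Lemma le1_bigcup I T (D : set I) (F : I -> set T) :
  D #<= omega1 -> (forall i, D i -> F i #<= omega1) ->
  \bigcup_(i in D) F i #<= omega1.
Proof.
move=> cD cF; apply: card_le_trans (le1X cD (card_lexx omega1)).
have /choice[e eP] (i : I) : exists e : T -> V, D i ->
    (forall x, F i x -> omega1 (e x)) /\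
    forall x y, F i x -> F i y -> e x = e y -> x = y.
  have [/cF/card_le_inj[e eP]|] := pselect (D i); first by exists e.
  by exists (fun=> vempty).
have [->|/set0P[i0 Di0]] := eqVneq D set0; first by rewrite bigcup_set0.
have /choice[r rP] (x : T) : exists i, (\bigcup_(i in D) F i) x -> D i /\ F i x.
  have [[a oa Fx]|] := pselect ((\bigcup_(a in D) F a) x); first by exists a.
  by exists i0.
apply: (inj_card_leE (f := fun x => (r x, e (r x) x))).
  by move=> x /rP[ox Fx]; split=> //=; apply: (eP _ ox).1.
move=> x y /set_mem/rP[ox Fx] /set_mem/rP[oy Fy] [rxy]; rewrite -rxy.
by apply: (eP _ ox).2 => //; rewrite rxy.
Qed.

Lemma countable_le1 T (A : set T) : countable A -> A #<= omega1.
Proof.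
move=> /card_le_inj[f [_ fI]]; apply: (inj_card_leE (f := vnat \o f)).
  by move=> x _; apply: omega1_iter_vsucc; split; [exact: ord_vempty|];
    rewrite (_ : ext _ = set0) // -subset0 => y /notin_vempty.
move=> x y /set_mem Ax /set_mem Ay /(iter_vsucc_inj ord_vempty); exact: fI.
Qed.

Lemma le1U T (A B : set T) : A #<= omega1 -> B #<= omega1 -> A `|` B #<= omega1.
Proof.
move=> cA cB; rewrite -bigcup2E; apply: le1_bigcup => [|[|[|i]] _] //=.
exact: countable_le1.
Qed.

(** After an injection into [omega1], each finite set is contained in a countable ordinal, which has
    only countably many finite subsets. *)
Lemma le1_finite_subsets T (W : set T) : W #<= omega1 ->
  [set B | finite_set B /\ B `<=` W] #<= omega1.
Proof.
move=> /card_le_inj[f [fW fI]].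
apply: card_le_trans (le1_bigcup_countable
  (F := fun c => [set A | A `<=` ext c /\ finite_set A]) _); last first.
  by move=> c [_ cc]; exact: countable_finite_subset.
apply: (inj_card_leE (f := fun B => f @` B)).
  move=> B [fB BW]; have [||c oc cP] := @omega1_bounded (f @` B).
  - by move=> _ [x /BW/fW ? <-].
  - exact/finite_set_countable/finite_image.
  by exists c => //; split; [|exact: finite_image].
suff sub B B' : B `<=` W -> B' `<=` W -> f @` B = f @` B' -> B `<=` B'.
  move=> B B' /set_mem[_ BW] /set_mem[_ BW'] e; apply/seteqP; split; exact: sub.
move=> BW BW' e x Bx; have : (f @` B') (f x) by rewrite -e; exists x.
by move=> [y By /fI<-] //; [exact: BW'|exact: BW].
Qed.

Lemma omega1_sub_omega2 : omega1 `<=` omega2.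
Proof. by move=> a [oa ca]; split=> //; exact: countable_le1. Qed.

Lemma omega2_vsucc (a : V) : omega2 a -> omega2 (vsucc a).
Proof.
move=> [oa ca]; split; first exact: ord_vsucc.
rewrite ext_vsucc; apply: le1_bigcup => [|[]] //; first exact: countable_le1.
by move=> _; apply/countable_le1/countable1.
Qed.

Lemma omega2_osup (X : set V) : X `<=` omega2 -> X #<= omega1 -> omega2 (osup X).
Proof.
move=> X2 cX; have oX x : X x -> ordinal x by move=> /X2/omega2_ord.
have [oS SE] := ord_osup (small_sub X2 small_omega2) oX; split=> //.
have -> : ext (osup X) = \bigcup_(x in X) ext x by apply/seteqP; split=> y /SE.
by apply: le1_bigcup => // x /X2[].
Qed.

Lemma omega2_bounded (X : set V) : X `<=` omega2 -> X #<= omega1 ->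
  exists2 d, omega2 d & forall x, X x -> x ∈ d.
Proof.
move=> X1 cX; have oX x : X x -> ordinal x by move=> /X1[].
have [oS SE] := ord_osup (small_sub X1 small_omega2) oX.
exists (vsucc (osup X)); first exact/omega2_vsucc/omega2_osup.
move=> x Xx; rewrite in_vsucc; apply/oleP => //; first exact: oX.
by move=> y yx; apply/SE; exists x.
Qed.

Lemma card_lt_omega2 T (A : set T) : A #<= omega1 -> card_lt A omega2.
Proof.
move=> A1; split.
  by apply: card_le_trans A1 _; exact: subset_card_le omega1_sub_omega2.
by apply/negP => A2; apply: omega2_not_le; exact: card_le_trans A2 A1.
Qed.

(** * Membership in H(omega2) *)

Lemma trcl_sub (x : V) (B : set V) : ext x `<=` B ->
  (forall y z, B y -> z ∈ y -> B z) -> trcl x `<=` B.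
Proof.
by move=> xB tB y; elim=> [z /xB//|z w _ Bz wz]; exact: tB Bz wz.
Qed.

Lemma H_trcl_le1 (x : V) (B : set V) : ext x `<=` B ->
  (forall y z, B y -> z ∈ y -> B z) -> B #<= omega1 -> H_omega2 x.
Proof.
move=> xB tB cB; apply: card_lt_omega2; apply: card_le_trans cB.
by apply: subset_card_le; exact: trcl_sub.
Qed.

Lemma omega2_H : omega2 `<=` H_omega2.
Proof.
move=> a [oa ca]; apply: (H_trcl_le1 (B := ext a)) => // y z ya zy.
exact: ord_trans zy ya.
Qed.

Lemma card_lt_sub T (A : set T) (B : set T) (C : set V) :
  A `<=` B -> card_lt B C -> card_lt A C.
Proof.
move=> /subset_card_le AB [BC CB]; split; first exact: card_le_trans AB BC.
by apply: contra CB => CA; exact: card_le_trans CA AB.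
Qed.

Lemma H_mem (x y : V) : H_omega2 x -> y ∈ x -> H_omega2 y.
Proof.
move=> Hx yx; apply: card_lt_sub Hx => z; elim=> [w wy|w u _ xw uw].
  by apply: trcl_trans wy; constructor.
exact: trcl_trans xw uw.
Qed.

Lemma H_sub (x y : V) : H_omega2 x -> ext y `<=` ext x -> H_omega2 y.
Proof.
move=> Hx yx; apply: card_lt_sub Hx => z; elim=> [w /yx|w u _ xw uw].
  by constructor.
exact: trcl_trans xw uw.
Qed.

Lemma H_le1 (x : V) : ext x `<=` omega2 -> ext x #<= omega1 -> H_omega2 x.
Proof.
move=> x2 cx; have [d /omega2_H Hd xd] := omega2_bounded x2 cx.
exact: H_sub Hd xd.
Qed.

(** * Skolem hulls *)

Definition FImp n (p q : formula n) : formula n := FNot (FAnd p (FNot q)).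
Definition FAll n (p : formula n.+1) : formula n := FNot (FEx (FNot p)).
Definition FIff n (p q : formula n) : formula n := FAnd (FImp p q) (FImp q p).

(* The arity is given explicitly so that [isT] proves the index bounds. *)
Notation fmem n i j := (@FMem n (@Ordinal n i isT) (@Ordinal n j isT)) (only parsing).
Notation feq n i j := (@FEq n (@Ordinal n i isT) (@Ordinal n j isT)) (only parsing).
Notation fpi n i j := (@FPi n (@Ordinal n i isT) (@Ordinal n j isT)) (only parsing).

Lemma sat_imp pi Y n (p q : formula n) e :
  sat pi Y (FImp p q) e <-> (sat pi Y p e -> sat pi Y q e).
Proof.
rewrite /FImp /=; split=> [h sp|h [sp]]; last by move=> []; exact: h.
by apply: contrapT => nq; apply: h.
Qed.

Lemma sat_all pi Y n (p : formula n.+1) e :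
  sat pi Y (FAll p) e <-> forall x, H_omega2 x -> sat pi Y p (tcons x e).
Proof.
rewrite /FAll /=; split=> [h x Hx|h [x /h sp]] //.
by apply: contrapT => nsp; apply: h; exists x.
Qed.

Lemma sat_iff pi Y n (p q : formula n) e :
  sat pi Y (FIff p q) e <-> (sat pi Y p e <-> sat pi Y q e).
Proof.
have -> : sat pi Y (FIff p q) e =
  (sat pi Y (FImp p q) e /\ sat pi Y (FImp q p) e) by [].
by rewrite !sat_imp.
Qed.

(** The [congr] lemmas compute the meaning of a long formula by following its syntax, one connective
    at a time. *)
Lemma sat_and_congr pi Y n (p q : formula n) e (P Q : Prop) :
  (sat pi Y p e <-> P) -> (sat pi Y q e <-> Q) ->
  (sat pi Y (FAnd p q) e <-> P /\ Q).
Proof. by move=> <- <-. Qed.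

Lemma sat_imp_congr pi Y n (p q : formula n) e (P Q : Prop) :
  (sat pi Y p e <-> P) -> (sat pi Y q e <-> Q) ->
  (sat pi Y (FImp p q) e <-> (P -> Q)).
Proof. by move=> <- <-; exact: sat_imp. Qed.

Lemma sat_all_congr pi Y n (p : formula n.+1) e (P : V -> Prop) :
  (forall x, H_omega2 x -> sat pi Y p (tcons x e) <-> P x) ->
  sat pi Y (FAll p) e <-> (forall x, H_omega2 x -> P x).
Proof. by move=> h; rewrite sat_all; split=> k x Hx; apply/(h x Hx)/k. Qed.

Definition F_inter : formula 3 :=
  FAll (FIff (fmem 4 0 1) (FAnd (fmem 4 0 2) (fmem 4 0 3))).

Lemma sat_inter pi Y x a b : sat pi Y F_inter (tcons x [tuple a; b]) <->
  forall z, H_omega2 z -> (z ∈ x <-> z ∈ a /\ z ∈ b).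
Proof.
rewrite /F_inter sat_all; split=> h z /h; first by move/sat_iff.
by move=> zx; apply/sat_iff.
Qed.

Definition F_pi : formula 2 := fpi 2 1 0.
Definition F_pi_inv : formula 2 := fpi 2 0 1.

Lemma sat_pi pi Y z x : sat pi Y F_pi (tcons z [tuple x]) <-> omega2 x /\ pi x = z.
Proof. by []. Qed.

Lemma sat_pi_inv pi Y z x :
  sat pi Y F_pi_inv (tcons z [tuple x]) <-> omega2 z /\ pi z = x.
Proof. by []. Qed.

(** Variable 0 is d and variable 1 is g. The first conjunct puts d in the domain of [pi], which is
    how the language expresses d < omega2; the second says that every a in Y with a ⊆ g has its
    index under [pi] in d. *)
Definition F_bound : formula 2 :=
  FAnd (FEx (fpi 3 1 0))
    (FAll (FImp
      (FAnd (@FY 3 (@Ordinal 3 0 isT)) (FAll (FImp (fmem 4 0 1) (fmem 4 0 3))))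
      (FEx (FAnd (fmem 4 0 2) (fpi 4 0 1))))).

Lemma sat_bound pi Y d g : sat pi Y F_bound (tcons d [tuple g]) <->
  (exists2 x, H_omega2 x & omega2 d /\ pi d = x) /\
  forall a, H_omega2 a -> Y a /\ (forall z, H_omega2 z -> z ∈ a -> z ∈ g) ->
    exists2 x, H_omega2 x & x ∈ d /\ omega2 x /\ pi x = a.
Proof.
apply: sat_and_congr => //; apply: sat_all_congr => a _.
apply: sat_imp_congr => //; apply: sat_and_congr => //.
by apply: sat_all_congr => z _; exact: sat_imp.
Qed.

Definition F_chain_cover : formula 2 :=
  FAll (FImp (fmem 3 0 2) (FEx (FAnd (fmem 4 0 2) (fmem 4 1 0)))).
Definition F_chain_bottom : formula 2 :=
  FAll (FAll (FImp
    (FAnd (FAnd (fmem 4 0 2) (FNot (FEx (FAnd (fmem 5 0 3) (fmem 5 0 1)))))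
          (FAnd (fmem 4 1 2) (FNot (FEx (FAnd (fmem 5 0 3) (fmem 5 0 2))))))
    (feq 4 0 1))).
Definition F_chain_succ : formula 2 :=
  FAll (FAll (FAll (FImp
    (FAnd (fmem 5 2 3)
      (FAnd (FAnd (fmem 5 0 3) (fmem 5 2 0)) (FAnd (fmem 5 1 3) (fmem 5 2 1))))
    (feq 5 0 1)))).
Definition F_chain_elem : formula 2 :=
  FAll (FAll (FAll (FImp
    (FAnd (fmem 5 2 3)
      (FAnd (FAnd (fmem 5 0 2) (fmem 5 0 4)) (FAnd (fmem 5 1 2) (fmem 5 1 4))))
    (feq 5 0 1)))).
Definition F_chain : formula 2 :=
  FAnd (FAnd F_chain_cover F_chain_bottom) (FAnd F_chain_succ F_chain_elem).

Definition minimal_in (w z : V) : Prop :=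
  z ∈ w /\ ~ exists2 y, H_omega2 y & y ∈ w /\ y ∈ z.

(* [w] codes an enumeration of [k] whose indices are the elements of [w]
   themselves: [w] is a chain under ∈ with unique bottom and unique successors,
   and each of its elements contains at most one element of [k]. *)
Definition chain_code (w k : V) : Prop :=
  ((forall x, H_omega2 x -> x ∈ k ->
      exists2 z, H_omega2 z & z ∈ w /\ x ∈ z) /\
   (forall z, H_omega2 z -> forall z', H_omega2 z' ->
      minimal_in w z' /\ minimal_in w z -> z' = z)) /\
  ((forall y, H_omega2 y -> forall z, H_omega2 z -> forall z', H_omega2 z' ->
      y ∈ w /\ (z' ∈ w /\ y ∈ z') /\ z ∈ w /\ y ∈ z -> z' = z) /\
   (forall z, H_omega2 z -> forall x, H_omega2 x -> forall x', H_omega2 x' ->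
      z ∈ w /\ (x' ∈ z /\ x' ∈ k) /\ x ∈ z /\ x ∈ k -> x' = x)).

Lemma sat_chain pi Y w k : sat pi Y F_chain (tcons w [tuple k]) <-> chain_code w k.
Proof.
apply: sat_and_congr; apply: sat_and_congr.
- by apply: sat_all_congr => x _; exact: sat_imp.
- do 2!(apply: sat_all_congr => ? _); exact: sat_imp.
- do 3!(apply: sat_all_congr => ? _); exact: sat_imp.
- do 3!(apply: sat_all_congr => ? _); exact: sat_imp.
Qed.

(** The next three formulas produce hull elements in [Sk_countable]: an ∈-minimal element of w, an
    element of w that contains a given y, and a common element of two sets. *)
Definition F_bottom : formula 2 :=
  FAnd (fmem 2 0 1) (FNot (FEx (FAnd (fmem 3 0 2) (fmem 3 0 1)))).
Definition F_mem_mem : formula 3 := FAnd (fmem 3 0 1) (fmem 3 2 0).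
Definition F_mem_both : formula 3 := FAnd (fmem 3 0 1) (fmem 3 0 2).

(** * Hulls in the structure (H(omega2), ∈, pi, Y) *)

Record setting (pi : V -> V) (Y : set V) (SF : fun_family) : Prop := Setting {
  pi_bij : set_bij omega2 H_omega2 pi;
  Y_sub : Y `<=` P_omega1_omega2;
  Y_thin : thin Y;
  Y_init : closed_initial_segments Y;
  SF_skolem : definable_skolem_functions pi Y SF }.

Lemma Sk_H pi Y SF (a : set V) : setting pi Y SF ->
  a `<=` H_omega2 -> Sk SF a `<=` H_omega2.
Proof.
move=> S aH x; elim=> [y /aH//|n f e SFf _ IH].
by have [def _] := SF_skolem S; have [h _] := def _ _ SFf; exact: h.
Qed.

Lemma Sk_witness pi Y SF (a : set V) n (p : formula n.+1) (e : n.-tuple V) :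
  setting pi Y SF -> a `<=` H_omega2 -> (forall i, Sk SF a (tnth e i)) ->
  (exists2 x, H_omega2 x & sat pi Y p (tcons x e)) ->
  exists x, Sk SF a x /\ sat pi Y p (tcons x e).
Proof.
move=> S aH ae ex; have [_ /(_ n p)[f SFf fP]] := SF_skolem S.
exists (f e); split; first exact: Sk_app.
by apply: fP => // i; exact: (Sk_H S aH).
Qed.

Lemma Sk_witness1 pi Y SF (a : set V) (p : formula 2) (x : V) :
  setting pi Y SF -> a `<=` H_omega2 -> Sk SF a x ->
  (exists2 z, H_omega2 z & sat pi Y p (tcons z [tuple x])) ->
  exists z, Sk SF a z /\ sat pi Y p (tcons z [tuple x]).
Proof.
move=> S aH ax ex; apply: Sk_witness ex => // i; rewrite (tnth_nth vempty).
by case: i => -[].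
Qed.

Lemma Sk_witness2 pi Y SF (a : set V) (p : formula 3) (x y : V) :
  setting pi Y SF -> a `<=` H_omega2 -> Sk SF a x -> Sk SF a y ->
  (exists2 z, H_omega2 z & sat pi Y p (tcons z [tuple x; y])) ->
  exists z, Sk SF a z /\ sat pi Y p (tcons z [tuple x; y]).
Proof.
move=> S aH ax ay ex; apply: Sk_witness ex => // i; rewrite (tnth_nth vempty).
by case: i => -[|[]].
Qed.

(** The pattern for all definable elements: the intersection is the only witness of a formula with
    parameters in the hull, so the Skolem function must return it. *)
Lemma Sk_inter pi Y SF (a : set V) (x y : V) : setting pi Y SF ->
  a `<=` H_omega2 -> Sk SF a x -> Sk SF a y -> Sk SF a (vinter x y).
Proof.
move=> S aH ax ay; have Hx := Sk_H S aH ax.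
have [|z [az /sat_inter zP]] := @Sk_witness2 pi Y SF a F_inter x y S aH ax ay.
  exists (vinter x y); first by apply: H_sub Hx _ => z /in_vinter[].
  by apply/sat_inter => z _; exact: in_vinter.
suff <- : z = vinter x y by [].
have Hz := Sk_H S aH az.
apply: ext_eq => u; rewrite in_vinter; split=> [uz|[ux uy]].
  by apply/zP => //; exact: H_mem uz.
by apply/zP => //; exact: H_mem ux.
Qed.

Lemma pi_H pi Y SF (x : V) : setting pi Y SF -> omega2 x -> H_omega2 (pi x).
Proof. by move=> S ox; have [h _ _] := pi_bij S; exact: h. Qed.

Lemma pi_inj pi Y SF (x y : V) : setting pi Y SF -> omega2 x -> omega2 y ->
  pi x = pi y -> x = y.
Proof. by move=> S ox oy; have [_ h _] := pi_bij S; apply: h; exact: mem_set. Qed.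

Lemma pi_surj pi Y SF (x : V) : setting pi Y SF -> H_omega2 x ->
  exists2 y, omega2 y & pi y = x.
Proof. by move=> S Hx; have [_ _ /(_ _ Hx)[y]] := pi_bij S; exists y. Qed.

Lemma Sk_pi pi Y SF (a : set V) (x : V) : setting pi Y SF ->
  a `<=` H_omega2 -> omega2 x -> Sk SF a x -> Sk SF a (pi x).
Proof.
move=> S aH ox ax; have [|z [az /sat_pi[_ e]]] := @Sk_witness1 pi Y SF a F_pi x S aH ax.
  by exists (pi x); [exact: (pi_H S)|split].
by rewrite e.
Qed.

Lemma Sk_pi_inv pi Y SF (a : set V) (x : V) : setting pi Y SF ->
  a `<=` H_omega2 -> omega2 x -> Sk SF a (pi x) -> Sk SF a x.
Proof.
move=> S aH ox ax.
have [|z [az /sat_pi_inv[oz e]]] := @Sk_witness1 pi Y SF a F_pi_inv (pi x) S aH ax.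
  by exists x; [exact: omega2_H|split].
by rewrite -(pi_inj S oz ox e).
Qed.

Lemma Y_ord pi Y SF (a z : V) : setting pi Y SF -> Y a -> z ∈ a -> omega2 z.
Proof. by move=> S /(Y_sub S)[a2 _] /a2. Qed.

Lemma Y_countable pi Y SF (a : V) : setting pi Y SF -> Y a -> countable (ext a).
Proof. by move=> S /(Y_sub S)[]. Qed.

Lemma Y_H pi Y SF (a : V) : setting pi Y SF -> Y a -> H_omega2 a.
Proof.
by move=> S /(Y_sub S)[a2 ca]; apply: H_le1 => //; exact: countable_le1.
Qed.

(** By thinness at most omega1 members of Y are subsets of g, so their indices under [pi] have a
    bound below omega2. Such a bound is definable from g, hence one lies in Sk(d) ∩ omega2 = d. *)
Lemma Cset_bound pi Y SF (d g a : V) : setting pi Y SF -> Cset SF d ->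
  g ∈ d -> Y a -> ext a `<=` ext g -> exists2 x, x ∈ d & pi x = a.
Proof.
move=> S [od dE] gd Ya ag.
have dH : ext d `<=` H_omega2 by move=> x /(omega2_mem od)/omega2_H.
have og := omega2_mem od gd.
have [|t [dt /sat_bound[[_ _ [ot _]] tP]]] :=
    @Sk_witness1 pi Y SF (ext d) F_bound g S dH (@Sk_base SF (ext d) g gd).
  have [||t ot tP] :=
      @omega2_bounded [set x | [/\ omega2 x, Y (pi x) & ext (pi x) `<=` ext g]].
  - by move=> x [].
  (* [pi] maps these indices injectively into the set of all a ∩ g with a in Y. *)
  - apply: card_le_trans (Y_thin S og); apply: (inj_card_leE (f := pi)).
      move=> x [ox Yx xg]; exists (pi x) => //.
      by apply: ext_eq => z; rewrite in_vinter; split=> [[]//|zx]; split=> //; exact: xg.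
    by move=> x y /set_mem[ox _ _] /set_mem[oy _ _]; exact: (pi_inj S).
  exists t; first exact: omega2_H.
  apply/sat_bound; split; first by exists (pi t) => //; exact: (pi_H S).
  move=> b Hb [Yb bg]; have [x ox xb] := pi_surj S Hb; exists x; first exact: omega2_H.
  split=> //; apply: tP; split=> //; rewrite xb // => z zb; apply: bg => //.
  exact: H_mem zb.
have td : ext d t by rewrite -dE.
have [x _ [xt [_ xa]]] := tP a (Y_H S Ya) (conj Ya (fun z _ => @ag z)).
by exists x => //; exact: (ord_trans (omega2_ord od) xt td).
Qed.

Lemma Lambda_bound pi Y SF (b g a : V) : setting pi Y SF -> Lambda SF b ->
  g ∈ b -> Y a -> ext a `<=` ext g -> exists2 x, x ∈ b & pi x = a.
Proof.
move=> S [ob _ [_ lb]] gb Ya ag; have [d [Cd db gd]] := lb _ gb.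
have [x xd xa] := Cset_bound S Cd gd Ya ag.
by exists x => //; exact: (ord_trans (omega2_ord ob) xd db).
Qed.

Lemma in_set2 (x y z : V) : z ∈ code [set x; y] <-> z = x \/ z = y.
Proof. by rewrite mem_codeE //; exact: small_set2. Qed.

(** The chain is u(0) = {d} and u(n+1) = {g(n), u(n)}, where g enumerates k and d is an ordinal
    above all elements of k. *)
Lemma chain_code_exists (k : V) : ext k `<=` omega2 -> countable (ext k) ->
  ext k !=set0 -> exists2 w, H_omega2 w & chain_code w k.
Proof.
move=> k2 ck [k0 k0k]; have /card_le_inj[f [_ fI]] := ck.
(* Where f does not take the value n on k, the default k0 keeps g n inside k. *)
pose g n := xget k0 [set x | x ∈ k /\ f x = n].
have gk n : g n ∈ k by rewrite /g; case: xgetP => // x _ [].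
have gf x : x ∈ k -> g (f x) = x.
  move=> xk; have [] : (g (f x) ∈ k) /\ f (g (f x)) = f x.
    by apply: (@xgetPex _ k0 [set y | y ∈ k /\ f y = f x]); exists x.
  by move=> gk' /fI; exact.
have [d od dP] := omega2_bounded k2 (countable_le1 ck).
pose u := fix u n := if n is m.+1 then code [set g m; u m] else code [set d; d].
(* This separates the links of the chain from d and from the elements of k. If u(n+1) were an
   ordinal, so would be its element u(n), and if {d} were one, transitivity would give k0 = d
   although k0 ∈ d. *)
have uN n : ~ ordinal (u n).
  elim: n => [|n IH] ou; last first.
    by apply: IH; apply: ord_mem ou _; apply/in_set2; right.
  have : k0 ∈ u 0 by apply: ord_trans ou (dP _ k0k) _; apply/in_set2; left.
  by rewrite in_set2 => -[] e; have := dP _ k0k; rewrite e => /vmem_irr.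
have uk n : ~ u n ∈ k by move=> /k2/omega2_ord; exact: uN.
have ud n : u n <> d by move=> e; apply: (uN n); rewrite e; case: od.
have u0 n : ~ u n ∈ u 0 by rewrite in_set2 => -[] /ud.
have uS m n : u m ∈ u n.+1 -> u m = u n.
  by rewrite in_set2 => -[e|//]; case: (uk m); rewrite e; exact: gk.
have uI : injective u.
  elim=> [|m IH] [|n] // e.
  - by case: (u0 n); rewrite e; apply/in_set2; right.
  - by case: (u0 m); rewrite -e; apply/in_set2; right.
  - by rewrite (IH n) //; apply: uS; rewrite -e; apply/in_set2; right.
have kuE n x : x ∈ u n -> x ∈ k -> exists2 m, n = m.+1 & x = g m.
  case: n => [|m]; rewrite in_set2 => -[->|->] //; last by move=> /uk.
  - by move=> /dP/vmem_irr.
  - by move=> /dP/vmem_irr.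
  - by exists m.
pose w := code (range u).
have wE x : x ∈ w <-> range u x.
  by rewrite mem_codeE //; apply: (@ext_code _ nat u).
have Hw : H_omega2 w.
  apply: (@H_trcl_le1 _ (range u `|` ext (vsucc d))).
  - by move=> x /wE ux; left.
  - move=> x y [[[|n] _ <-]|xd yx].
    + by rewrite in_set2 => -[] ->; right; apply/in_vsucc; right.
    + rewrite in_set2 => -[] ->; last by left; exists n.
      by right; apply/in_vsucc; left; exact/dP/gk.
    + by right; apply: ord_trans yx xd; apply: ord_vsucc; case: od.
  - apply: le1U; last by case: (omega2_vsucc od).
    by apply: countable_le1; exact: card_le_trans (card_image_le _ _) _.
have Hu n : H_omega2 (u n) by apply: H_mem Hw _; apply/wE; exists n.
exists w => //; split; split.
- move=> x _ xk; exists (u (f x).+1) => //; split; first by apply/wE; exists (f x).+1.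
  by apply/in_set2; left; rewrite gf.
- have min0 z : minimal_in w z -> z = u 0.
    move=> [/wE[[|n] _ <-] // no]; case: no; exists (u n) => //; split.
      by apply/wE; exists n.
    by apply/in_set2; right.
  by move=> z _ z' _ [/min0-> /min0->].
- move=> y _ z _ z' _ [/wE[n _ <-] [[/wE[n' _ <-] yz'] [/wE[m _ <-] yz]]].
  case: n' yz' => [/u0//|n'] /uS/uI <-; case: m yz => [/u0//|m] /uS/uI <-//.
- move=> z _ x _ x' _ [/wE[n _ <-] [[xz' xk'] [xz xk]]].
  have [m em ->] := kuE _ _ xz xk; have [m' + ->] := kuE _ _ xz' xk'.
  by rewrite em => -[->].
Qed.

(* The index chain lies in the hull by ∈-induction, so no internal notion of
   natural number is needed. *)
Lemma Sk_countable pi Y SF (a : set V) (k : V) : setting pi Y SF ->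
  a `<=` H_omega2 -> ext k `<=` omega2 -> countable (ext k) ->
  Sk SF a k -> ext k `<=` Sk SF a.
Proof.
move=> S aH k2 ck ak x xk.
have [w' Hw' w'k] := chain_code_exists k2 ck (ex_intro _ x xk).
have [|w [aw /sat_chain[[cov bot] [suc el]]]] :=
    @Sk_witness1 pi Y SF a F_chain k S aH ak.
  by exists w' => //; exact/sat_chain.
have Hw := Sk_H S aH aw; have Hk := Sk_H S aH ak.
have wS : forall z, z ∈ w -> Sk SF a z.
  apply: vmem_ind => z IH zw; have Hz := H_mem Hw zw.
  (* If z has an element y in w, then z is the only element of w containing y, and y is in the hull
     by induction. Otherwise z is the unique bottom of w. *)
  have [[y Hy [yw yz]]|no] := pselect (exists2 y, H_omega2 y & y ∈ w /\ y ∈ z).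
    have [|t [at_ [tw yt]]] := @Sk_witness2 pi Y SF a F_mem_mem w y S aH aw (IH _ yz yw).
      by exists z => //; split.
    by rewrite (suc y Hy t (Sk_H S aH at_) z Hz).
  have [|t [at_ tP]] := @Sk_witness1 pi Y SF a F_bottom w S aH aw.
    by exists z => //; split.
  by rewrite (bot t (Sk_H S aH at_) z Hz).
(* Some link z contains x, and x is the only element of k in z, so any witness found in the hull is
   x. *)
have Hx := H_mem Hk xk; have [z Hz [zw xz]] := cov x Hx xk.
have [|t [at_ [tz tk]]] := @Sk_witness2 pi Y SF a F_mem_both z k S aH (wS _ zw) ak.
  by exists x => //; split.
by rewrite (el z Hz t (Sk_H S aH at_) x Hx).
Qed.

(** Being countable and in the hull of P, the set Q ∩ b' is included in P. If e is the least element
    of P not below b, then Q ∩ b is the intersection of Q ∩ b' with e; if there is no such e, then Q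
    ∩ b = Q ∩ b'. *)
Lemma Sk_initial_segment pi Y SF (P Q b b' : V) : setting pi Y SF ->
  Xset Y SF P -> Y Q -> omega2 b -> omega2 b' -> ole b b' ->
  Sk SF (ext P) (vinter Q b') -> Sk SF (ext P) (vinter Q b).
Proof.
move=> S [YP PE _] YQ ob ob' bb' PQ.
have P2 z : z ∈ P -> omega2 z by exact: (Y_ord S).
have PH : ext P `<=` H_omega2 by move=> z /P2/omega2_H.
have YQ' := Y_init S YQ ob'.
have QP z : z ∈ Q -> z ∈ b' -> z ∈ P.
  move=> zQ zb'; have : (Sk SF (ext P) `&` omega2) z; last by rewrite PE.
  split; last exact: (Y_ord S YQ).
  apply: (Sk_countable S PH _ _ PQ); last exact/in_vinter.
    by move=> y; exact: (Y_ord S).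
  exact: (Y_countable S).
have bsub z : z ∈ b -> z ∈ b' by move=> zb; exact: (lt_ole_trans (omega2_ord ob') zb bb').
have [[e0 [e0P e0b]]|no] := pselect (exists e, e ∈ P /\ ~ e ∈ b); last first.
  suff -> : vinter Q b = vinter Q b' by [].
  apply: ext_eq => z; rewrite !in_vinter; split=> -[zQ zb]; split=> //; first exact: bsub.
  by apply: contrapT => nzb; apply: no; exists z; split=> //; exact: QP.
have [//|z [/P2/omega2_ord//]|e [[eP eb] emin]] := @ord_min [set e | e ∈ P /\ ~ e ∈ b] e0.
suff <- : vinter (vinter Q b') e = vinter Q b.
  by apply: Sk_inter S PH PQ _; exact: Sk_base.
have oe := omega2_ord (P2 _ eP).
apply: ext_eq => z; rewrite !in_vinter; split=> [[[zQ zb'] ze]|[zQ zb]].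
  split=> //; apply: contrapT => nzb.
  have /(oleNgt oe (ord_mem oe ze))// : ole e z by apply: emin; split=> //; exact: QP.
split; first by split=> //; exact: bsub.
apply: lt_ole_trans zb _ => //; apply/oleNgt => //; exact: omega2_ord.
Qed.

(** * Comparison points *)

(** The ordinals of omega2 above a form a club. *)
Lemma stationary_unbounded (Gamma : set V) (a : V) :
  stationary_omega2 Gamma -> omega2 a -> exists2 g, Gamma g & a ∈ g.
Proof.
move=> [_ st] oa; have [|g [[_ ag] Gg]] := st [set d | omega2 d /\ a ∈ d].
  split=> [d []//|x ox|b ob [b0 lb]].
    have [||d od dP] := @omega2_bounded [set a; x].
    - by move=> _ [->|->].
    - exact/countable_le1/finite_set_countable/finite_set2.
    by exists d; [split=> //; apply: dP; left|apply: dP; right].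
  split=> //; have [[c cb]|no] := pselect (exists c, c ∈ b).
    by have [d [[_ ad] db _]] := lb _ cb; exact: (ord_trans (omega2_ord ob) ad db).
  case: b0; apply: ext_eq => z; split=> [zb|/notin_vempty//].
  by case: no; exists z.
by exists g.
Qed.

(** Otherwise X would be cofinal in b, and [omega1] would be countable. *)
Lemma cofinality_omega1_bound (b : V) (X : set V) : ordinal b ->
  has_cofinality b omega1 -> X `<=` ext b -> countable X ->
  exists2 g, g ∈ b & forall x, X x -> x ∈ g.
Proof.
move=> ob [_ cof] Xb cX; apply: contrapT => no; apply: omega1_uncountable.
apply: sub_countable cX; apply: cof; split=> // c cb; apply: contrapT => nc.
apply: no; exists c => // x Xx; apply: contrapT => xc; apply: nc; exists x => //.
by apply/oleNgt => //; apply: ord_mem ob _ => //; exact: Xb.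
Qed.

(** Eliminates the supremum: Gamma misses [sup(M ∩ b), b) exactly when every point of Gamma below b
    is below some element of M ∩ b. *)
Lemma Gamma_atP pi Y SF (Gamma : set V) (M b : V) : setting pi Y SF ->
  Gamma `<=` omega2 -> Y M -> Gamma_at Gamma M b <->
  Gamma b /\ forall g, Gamma g -> g ∈ b -> exists z, [/\ z ∈ M, z ∈ b & g ∈ z].
Proof.
move=> S G2 YM; have sub : ext (vinter M b) `<=` omega2.
  by move=> z /in_vinter[zM _]; exact: (Y_ord S YM).
have [_ supE] := ord_osup (small_ext (vinter M b)) (fun x h => omega2_ord (sub x h)).
split=> [[Gb [_ bmin]]|[Gb h]].
  split=> // g Gg gb; apply: contrapT => no.
  have /(oleNgt (omega2_ord (G2 _ Gb)) (omega2_ord (G2 _ Gg))) : ole b g; last exact.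
  apply: bmin; split=> // /supE[z /in_vinter[zM zb] gz].
  by apply: no; exists z.
split=> //; split.
  by split=> // /supE[z /in_vinter[_ zb] bz]; exact: vmem_asym zb bz.
move=> g [Gg ng]; apply/oleNgt; [exact/omega2_ord/G2|exact/omega2_ord/G2|].
move=> gb; have [z [zM zb gz]] := h _ Gg gb.
by apply: ng; apply/supE; exists z => //; apply/in_vinter.
Qed.

(** A point of Gamma above sup M bounds the common points. The least b in Gamma that bounds them is
    itself common: by minimality any h in Gamma below b is below a common point s, so M and N both
    have elements between h and s. *)
Lemma beta_cmp_max pi Y SF (Gamma : set V) (M N : V) : setting pi Y SF ->
  stationary_omega2 Gamma -> Y M -> Y N ->
  is_max (Gamma_at Gamma M `&` Gamma_at Gamma N) (beta_cmp Gamma M N).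
Proof.
move=> S st YM YN; apply: xgetPex; have G2 := st.1.
have oG g : Gamma g -> ordinal g by move=> /G2/omega2_ord.
have GE := Gamma_atP _ S G2.
have [d od dP] : exists2 d, omega2 d & forall z, z ∈ M -> z ∈ d.
  apply: omega2_bounded; first by move=> z; exact: (Y_ord S).
  exact/countable_le1/(Y_countable S).
have [g Gg dg] := stationary_unbounded st od.
set A := _ `&` _.
have [|x [/oG//]|b [[Gb bA] bmin]] :=
  @ord_min [set x | Gamma x /\ forall s, A s -> ole s x] g.
  split=> // s [/(GE _ _ YM)[Gs h] _]; apply/oleNgt; [exact: oG|exact: oG|].
  move=> /(h _ Gg)[z [/dP zd _ gz]]; exact: vmem_cyc3 dg gz zd.
have low h : Gamma h -> h ∈ b -> exists2 s, A s & h ∈ s.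
  move=> Gh hb; apply: contrapT => no.
  have /(oleNgt (oG _ Gb) (oG _ Gh)) : ole b h; last exact.
  apply: bmin; split=> // s As; apply/oleNgt; [exact: oG As.1.1|exact: oG|].
  by move=> hs; apply: no; exists s.
exists b; split; last exact: bA.
split; apply/GE => //; split=> // h Gh hb; have [s As hs] := low _ Gh hb.
  have [_ /(_ _ Gh hs)[z [zM zs hz]]] := (GE _ _ YM).1 As.1.
  by exists z; split=> //; exact: (lt_ole_trans (oG _ Gb) zs (bA _ As)).
have [_ /(_ _ Gh hs)[z [zM zs hz]]] := (GE _ _ YN).1 As.2.
by exists z; split=> //; exact: (lt_ole_trans (oG _ Gb) zs (bA _ As)).
Qed.

Lemma beta_cmpC (Gamma : set V) (M N : V) :
  beta_cmp Gamma M N = beta_cmp Gamma N M.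
Proof. by rewrite /beta_cmp setIC. Qed.

Definition compared (SF : fun_family) (Gamma : set V) (M N : V) : Prop :=
  let b := beta_cmp Gamma M N in
  [\/ vinter M b = vinter N b, Sk SF (ext N) (vinter M b) |
      Sk SF (ext M) (vinter N b)].

Lemma comparedC SF Gamma M N : compared SF Gamma M N -> compared SF Gamma N M.
Proof. by rewrite /compared/= beta_cmpC => -[?|?|?]; [exact: Or31|exact: Or33|exact: Or32]. Qed.

(* [N] and its reflection [N'] agree below [b'], and the gaps at [b'] and [b]
   push the comparison point of [M] and [N] below [b']. *)
Lemma compared_reflect pi Y SF (Gamma : set V) (M N N' b b' g : V) :
  setting pi Y SF -> Gamma `<=` Lambda SF -> stationary_omega2 Gamma ->
  Xset Y SF M -> Xset Y SF N -> Xset Y SF N' ->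
  Gamma b -> Gamma b' -> b' ∈ b -> g ∈ b' ->
  ext M `<=` ext b ->
  (forall z, z ∈ N -> z ∈ b -> z ∈ g) ->
  (forall z, z ∈ N' -> z ∈ b' -> z ∈ g) ->
  vinter N g = vinter N' g ->
  compared SF Gamma M N' -> compared SF Gamma M N.
Proof.
move=> S GL st XM XN XN' Gb Gb' b'b gb' Mb Ngap N'gap NN'.
have [YM YN YN'] : [/\ Y M, Y N & Y N'] by case: XM XN XN' => ? _ _ [? _ _] [].
have G2 := st.1; have oG x : Gamma x -> ordinal x by move=> /G2/omega2_ord.
have GE := Gamma_atP _ S G2.
rewrite /compared; set c := beta_cmp Gamma M N; set c' := beta_cmp Gamma M N'.
have [[cM cN] _] : is_max (Gamma_at Gamma M `&` Gamma_at Gamma N) c.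
  exact: (beta_cmp_max S st YM YN).
have [[c'M c'N'] c'max] : is_max (Gamma_at Gamma M `&` Gamma_at Gamma N') c'.
  exact: (beta_cmp_max S st YM YN').
have [Gc cMP] := (GE _ _ YM).1 cM; have [_ cNP] := (GE _ _ YN).1 cN.
have Gc' := c'M.1.
have [oc [oc' [ob ob']]] := (oG _ Gc, (oG _ Gc', (oG _ Gb, oG _ Gb'))).
(* If b were below c, then M would have an element above b, against M ⊆ b. *)
have cb : ole c b.
  apply/oleNgt => // bc; have [z [/Mb zb _ bz]] := cMP _ Gb bc.
  exact: vmem_asym zb bz.
(* If b' were below c, then N would have an element between b' and c, hence one in the gap [g,
   b). *)
have cb' : ole c b'.
  apply/oleNgt => // b'c; have [z [zN zc b'z]] := cNP _ Gb' b'c.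
  have zg : z ∈ g by apply: Ngap zN _; exact: lt_ole_trans zc cb.
  exact: vmem_cyc3 gb' b'z zg.
(* Below c the gaps push the elements of N and N' under g, where the two models agree. *)
have NE z : z ∈ c -> z ∈ N <-> z ∈ N'.
  move=> zc; have zb' : z ∈ b' by exact: lt_ole_trans zc cb'.
  have zb : z ∈ b by exact: ord_trans zb' b'b.
  split=> [zN|zN'].
    by have : z ∈ vinter N g; [apply/in_vinter; split=> //; exact: Ngap|];
      rewrite NN' => /in_vinter[].
  by have : z ∈ vinter N' g; [apply/in_vinter; split=> //; exact: N'gap|];
    rewrite -NN' => /in_vinter[].
have vNE : vinter N c = vinter N' c.
  by apply: ext_eq => z; rewrite !in_vinter; split=> -[+ zc] => /(NE _ zc).
have cN' : Gamma_at Gamma N' c.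
  apply/(GE _ _ YN'); split=> // h Gh hc; have [z [zN zc hz]] := cNP _ Gh hc.
  by exists z; split=> //; apply/NE.
have cc' : ole c c' by apply: c'max.
have [o2c o2c'] := (G2 _ Gc, G2 _ Gc').
have H2 a : ext a `<=` omega2 -> ext a `<=` H_omega2 by move=> h z /h/omega2_H.
case=> [e|SN'|SM].
- apply: Or31; apply: ext_eq => z; rewrite vNE !in_vinter.
  have E : z ∈ c -> z ∈ M <-> z ∈ N'.
    move=> zc; have zc' : z ∈ c' by exact: lt_ole_trans zc cc'.
    have : z ∈ vinter M c' <-> z ∈ vinter N' c' by rewrite e.
    by rewrite !in_vinter; tauto.
  by split=> -[+ zc] => /(E zc).
(* M ∩ c is in Sk(N'), and the task is to move it to Sk(N). As c has cofinality omega1, M ∩ c is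
   bounded below c, so its index x under [pi] is below c. Then x is in N' and so in N, and M ∩ c =
   [pi x] is in Sk(N). *)
- apply: Or32; have SK := Sk_initial_segment S XN' YM o2c o2c' cc' SN'.
  have YK := Y_init S YM o2c.
  have [|||h hc Kh] := cofinality_omega1_bound (X := ext (vinter M c)) oc.
  + by have [] := GL _ Gc.
  + by move=> z /in_vinter[].
  + exact: (Y_countable S YK).
  have [x xc xK] := Lambda_bound S (GL _ Gc) hc YK Kh.
  have ox := omega2_mem o2c xc.
  have [_ N'E _] := XN'.
  have xN' : x ∈ N'.
    suff : (Sk SF (ext N') `&` omega2) x by rewrite N'E.
    split=> //; apply: (Sk_pi_inv S) => //; last by rewrite xK.
    by apply: H2 => z; exact: (Y_ord S).
  rewrite -xK; apply: (Sk_pi S) => //; first by apply: H2 => z; exact: (Y_ord S).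
  by apply: Sk_base; apply/NE.
- by apply: Or33; rewrite vNE; exact: Sk_initial_segment S XM YN' o2c o2c' cc' SM.
Qed.

(** Only mixed pairs need an argument: M in A and N in B are compared through a member N' of A that
    agrees with N below g. *)
Lemma adequate_setU pi Y SF (Gamma A B : set V) (b b' g : V) :
  setting pi Y SF -> Gamma `<=` Lambda SF -> stationary_omega2 Gamma ->
  adequate Y SF Gamma A -> adequate Y SF Gamma B ->
  Gamma b -> Gamma b' -> b' ∈ b -> g ∈ b' ->
  (forall M, A M -> ext M `<=` ext b) ->
  (forall N z, B N -> z ∈ N -> z ∈ b -> z ∈ g) ->
  (forall N z, A N -> z ∈ N -> z ∈ b' -> z ∈ g) ->
  (forall N, B N -> exists2 N', A N' & vinter N g = vinter N' g) ->
  adequate Y SF Gamma (A `|` B).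
Proof.
move=> S GL st [AX Acmp] [BX Bcmp] Gb Gb' b'b gb' Ab Bgap Agap refl.
have cross M N : A M -> B N -> compared SF Gamma M N.
  move=> AM BN; have [N' AN' e] := refl N BN.
  apply: (compared_reflect S GL st (AX _ AM) (BX _ BN) (AX _ AN') Gb Gb' b'b gb') => //.
  - exact: Ab.
  - by move=> z; exact: Bgap.
  - by move=> z; exact: Agap.
  - exact: Acmp.
split=> [M [/AX|/BX]//|M N [AM|BM] [AN|BN]].
- exact: Acmp.
- exact: cross.
- exact/comparedC/cross.
- exact: Bcmp.
Qed.

(** * Trees and conditions *)

(** The graph of [cfun] as a relation on V, so that labellings of different conditions can be
    compared although their domains are different types. *)
Definition labels Y SF Gamma (c : condition Y SF Gamma) (a v : V) : Prop :=
  exists a' : maximal_node (ctree c), set_val a' = a /\ set_val (cfun c a') = v.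

Lemma tree_mem (T : finite_tree) a b : tlt T a b -> a ∈ b.
Proof. by case: T => ? ? ? ? ? ? ? ? h; exact: h. Qed.

Lemma tree_node (T : finite_tree) a b : tlt T a b -> node T a /\ node T b.
Proof. by case: T => ? ? ? ? h ? ? ? ?; exact: h. Qed.

Lemma tree_irr (T : finite_tree) a : ~ tlt T a a.
Proof. by move=> /tree_mem/vmem_irr. Qed.

Lemma tree_trans (T : finite_tree) a b c : tlt T a b -> tlt T b c -> tlt T a c.
Proof. by case: T => ? ? ? ? ? ? h ? ?; exact: h. Qed.

Lemma tree_linear (T : finite_tree) a b c :
  tlt T a c -> tlt T b c -> [\/ a = b, tlt T a b | tlt T b a].
Proof. by case: T => ? ? ? ? ? ? ? h ?; exact: h. Qed.

Lemma tree_omega1 (T : finite_tree) : node T `<=` omega1.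
Proof. by case: T. Qed.

Lemma tree_finite (T : finite_tree) : finite_set (node T).
Proof. by case: T. Qed.

Lemma tle_node (T : finite_tree) a b : tle T a b -> node T b -> node T a.
Proof. by move=> [/tree_node[]|->]. Qed.

Lemma tle_linear (T : finite_tree) a b c :
  tle T a c -> tle T b c -> [\/ a = b, tlt T a b | tlt T b a].
Proof.
move=> [ac|->] [bc|->]; first exact: tree_linear bc.
- exact: Or32.
- exact: Or33.
- exact: Or31.
Qed.

Lemma finite_ord_max (A : set V) : finite_set A -> A !=set0 ->
  (forall x, A x -> ordinal x) -> exists m, is_max A m.
Proof.
move=> /finite_seqP[s ->] [x0 x0s]; elim: s x0 x0s => //= x s IH x0 _ oA.
have ox : ordinal x by apply: oA; rewrite /= mem_head.
have os y : y \in s -> ordinal y by move=> ys; apply: oA; rewrite /= inE ys orbT.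
case: s IH oA os => [|y s] IH oA os.
  exists x; split=> [|y]; rewrite /= inE //.
  by move=> /eqP->; right.
have [|m [ms mmax]] := IH y _ os; first by rewrite mem_head.
have om : ordinal m by exact: os.
have [mx|xm] := pselect (m ∈ x).
  exists x; split=> [|z]; rewrite /= inE ?eqxx //.
  move=> /orP[/eqP->|zs]; [by right|left].
  exact: ole_lt_trans (mmax z zs) mx.
exists m; split=> [|z]; first by rewrite /= inE ms orbT.
rewrite /= inE => /orP[/eqP->|zs]; last exact: mmax.
by apply/oleNgt.
Qed.

(** The ∈-largest node at or above a is maximal, because the tree order refines ∈. *)
Lemma maximal_above (T : finite_tree) a : node T a ->
  exists2 m, maximal_node T m & tle T a m.
Proof.
move=> Ta; have sub b : tle T a b -> node T b.
  by move=> [/tree_node[]|<-].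
have [||x ax|m [am mmax]] := @finite_ord_max [set b | tle T a b].
- by apply: sub_finite_set (tree_finite T) => b; exact: sub.
- by exists a; right.
- by have [] := tree_omega1 (sub _ ax).
exists m => //; split=> [|b mb]; first exact: sub.
have ab : tle T a b by left; case: am => [am|->//]; exact: tree_trans am mb.
have := tree_mem mb; case: (mmax b ab) => [bm|->]; last exact: vmem_irr.
exact: vmem_asym.
Qed.

Lemma fresh_nodes (A B : set V) : finite_set A -> A `<=` omega1 ->
  countable B -> exists nu : V -> V,
  [/\ forall v, omega1 (nu v), forall a v, A a -> a ∈ nu v &
      forall v w, B v -> B w -> nu v = nu w -> v = w].
Proof.
move=> fA A1 /card_le_inj[f [_ fI]].
have [d od dP] := omega1_bounded A1 (finite_set_countable fA).
exists (fun v => iter (f v) vsucc d); split.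
- by move=> v; exact: omega1_iter_vsucc.
- move=> a v /dP ad; elim: (f v) => //= n; rewrite in_vsucc; by left.
- by move=> v w Bv Bw /(iter_vsucc_inj od.1) /fI; exact.
Qed.

(** R a v says that a is to carry the label v; one node may carry several labels. Each label v gets
    a fresh node [nu v] directly above its node a, larger than all ordinals of T. *)
Lemma graft_tree (T : finite_tree) (R : V -> V -> Prop) :
  (forall a v, R a v -> maximal_node T a) ->
  (forall a, maximal_node T a -> exists v, R a v) ->
  (forall a b v, R a v -> R b v -> a = b) ->
  finite_set [set v | exists a, R a v] ->
  exists (U : finite_tree) (nu : V -> V),
  [/\ end_extends U T,
      forall b, maximal_node U b -> exists a v, R a v /\ b = nu v,
      forall a v, R a v -> maximal_node U (nu v),
      forall a v c, R a v -> (tlt U c (nu v) <-> tle T c a) &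
      forall a b v w, R a v -> R b w -> nu v = nu w -> v = w].
Proof.
move=> Rmax Rtot Rinj Rfin.
have [nu [nu1 above nuI]] :=
  fresh_nodes (tree_finite T) (@tree_omega1 T) (finite_set_countable Rfin).
have nuI' a b v w : R a v -> R b w -> nu v = nu w -> v = w.
  by move=> Rv Rw; apply: nuI; [exists a|exists b].
have fresh v : ~ node T (nu v) by move=> /(above _ v)/vmem_irr.
pose N := node T `|` nu @` [set v | exists a, R a v].
pose L c d := tlt T c d \/ exists a v, [/\ R a v, d = nu v & tle T c a].
have LN c v a : R a v -> L c (nu v) <-> tle T c a.
  move=> Rv; split=> [[/tree_node[_ /fresh]//|[b [w [Rw e ca]]]]|ca].
    by have vw := nuI' _ _ _ _ Rv Rw e; subst w; rewrite (Rinj _ _ _ Rv Rw).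
  by right; exists a, v.
have LT c d : node T d -> L c d <-> tlt T c d.
  by move=> Td; split=> [[//|[a [v [_ e _]]]]|]; [case: (fresh v); rewrite -e|left].
have Lnode c d : L c d -> node T c.
  by move=> [/tree_node[]|[a [v [/Rmax[Ta _] _ /tle_node]]]] //; exact.
have fN : finite_set N by rewrite finite_setU; split; [exact: tree_finite|exact: finite_image].
have N1 : N `<=` omega1 by move=> x [/tree_omega1//|[v _ <-]].
have LNN a b : L a b -> N a /\ N b.
  move=> ab; split; first by left; exact: Lnode ab.
  by case: ab => [/tree_node[_ Tb]|[c [v [Rv -> _]]]]; [left|right; exists v => //; exists c].
have Lirr a : ~ L a a.
  by move=> aa; move: (aa); rewrite LT; [exact: tree_irr|exact: Lnode aa].
have Ltrans a b c : L a b -> L b c -> L a c.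
  move=> + bc; rewrite LT; last exact: Lnode bc.
  move=> ab; case: bc => [bc|[d [v [Rv -> bd]]]]; first by left; exact: tree_trans bc.
  by right; exists d, v; split=> //; left; case: bd => [bd|<-//]; exact: tree_trans bd.
have Llin a b c : L a c -> L b c -> [\/ a = b, L a b | L b a].
  have W : [\/ a = b, tlt T a b | tlt T b a] -> [\/ a = b, L a b | L b a].
    by case=> [|ab|ba]; [exact: Or31|apply: Or32; left|apply: Or33; left].
  move=> [ac|[d [v [Rv -> ad]]]].
    rewrite LT; last by case: (tree_node ac).
    by move=> bc; apply: W; exact: tree_linear bc.
  by rewrite (LN _ _ _ Rv) => bd; apply: W; exact: tle_linear bd.
have Lmem a b : L a b -> a ∈ b.
  move=> ab; case: (ab) => [/tree_mem//|[c [v [_ -> _]]]].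
  by apply: above; exact: Lnode ab.
exists (FiniteTree N1 fN LNN Lirr Ltrans Llin Lmem), nu; split=> //=.
- by split=> [x|a b _ Tb]; [left|exact: LT].
(* An old node cannot stay maximal: a maximal node of T above it has a label and hence a new node
   over it. *)
- move=> b [/= [Tb|[v [a Rv] <-]] bmax]; last by exists a, v.
  have [m mT bm] := maximal_above Tb; have [v Rv] := Rtot _ mT.
  by case: (bmax (nu v)); right; exists m, v.
- move=> a v Rv; split=> [|b /Lnode/fresh//]; right; exists v => //; by exists a.
- by move=> a v c; exact: LN.
Qed.

Lemma labels_maximal Y SF Gamma (c : condition Y SF Gamma) a v :
  labels c a v -> maximal_node (ctree c) a.
Proof. by move=> [a' [<- _]]; exact: set_valP. Qed.

Lemma labels_omega2 Y SF Gamma (c : condition Y SF Gamma) a v :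
  labels c a v -> omega2 v.
Proof. by move=> [a' [_ <-]]; exact: set_valP. Qed.

Lemma labels_total Y SF Gamma (c : condition Y SF Gamma) a :
  maximal_node (ctree c) a -> exists v, labels c a v.
Proof.
move=> ma; pose a' : maximal_node (ctree c) := SigSub (mem_set ma).
by exists (set_val (cfun c a')), a'.
Qed.

Lemma labels_fun Y SF Gamma (c : condition Y SF Gamma) a v w :
  labels c a v -> labels c a w -> v = w.
Proof. by move=> [a' [<- <-]] [b' [/val_inj-> <-]]. Qed.

Lemma labels_inj Y SF Gamma (c : condition Y SF Gamma) a b v :
  labels c a v -> labels c b v -> a = b.
Proof.
have cI : injective (cfun c) by case: c.
by move=> [a' [<- <-]] [b' [<- /val_inj/cI->]].
Qed.

Lemma labels_side Y SF Gamma (c : condition Y SF Gamma) M a b v w d :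
  cside c M -> a <> b -> labels c a v -> labels c b w -> v ∈ M -> w ∈ M ->
  tlt (ctree c) d a -> tlt (ctree c) d b -> d ∈ M.
Proof.
case: c => T F A FI fA adA side /= AM ab [a' [ea <-]] [b' [eb <-]] vM wM da db.
by apply: (side M a' b') => //=; [move=> e; apply: ab; rewrite -ea -eb e|rewrite ea|rewrite eb].
Qed.

Lemma cside_finite Y SF Gamma (c : condition Y SF Gamma) : finite_set (cside c).
Proof. by case: c. Qed.

Lemma cside_adequate Y SF Gamma (c : condition Y SF Gamma) :
  adequate Y SF Gamma (cside c).
Proof. by case: c. Qed.

Lemma labels_finite Y SF Gamma (c : condition Y SF Gamma) :
  finite_set [set av | labels c av.1 av.2].
Proof.
have fM : finite_set (maximal_node (ctree c)).
  by apply: sub_finite_set (tree_finite (ctree c)) => a [].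
have /choice[f fP] (a : V) : exists v, maximal_node (ctree c) a -> labels c a v.
  have [/labels_total[v]|] := pselect (maximal_node (ctree c) a); first by exists v.
  by exists vempty.
apply: sub_finite_set (finite_image (fun a => (a, f a)) fM).
move=> [a v] /= av; have ma := labels_maximal av; exists a => //.
by rewrite (labels_fun av (fP _ ma)).
Qed.

(** Choice turns the label relation R into a function; the labels of the resulting condition are
    among those allowed by R. *)
Lemma condition_of_labels Y SF Gamma (T : finite_tree) (R : V -> V -> Prop)
    (A : set V) :
  (forall a, maximal_node T a -> exists v, omega2 v /\ R a v) ->
  (forall a b v, R a v -> R b v -> a = b) ->
  finite_set A -> adequate Y SF Gamma A ->
  (forall M a b v w d, A M -> a <> b -> R a v -> R b w -> v ∈ M -> w ∈ M ->
     tlt T d a -> tlt T d b -> d ∈ M) ->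
  exists c : condition Y SF Gamma, [/\ ctree c = T, cside c = A &
    forall a, maximal_node T a -> exists v, labels c a v /\ R a v].
Proof.
move=> Rtot Rinj fA adA side.
have /choice[F FP] (a : maximal_node T) : exists v : omega2, R (set_val a) (set_val v).
  have [v [ov Rv]] := Rtot _ (set_valP a); by exists (SigSub (mem_set ov)).
have FI : injective F.
  move=> a b e; apply/val_inj; apply: (Rinj (set_val a) (set_val b) (set_val (F a))) => //.
  by rewrite e.
have Fside (M : V) (a b : maximal_node T) : A M -> a <> b ->
    set_val (F a) ∈ M -> set_val (F b) ∈ M ->
    forall c, tlt T c (set_val a) -> tlt T c (set_val b) -> c ∈ M.
  move=> AM ab aM bM c; apply: side AM _ (FP a) (FP b) aM bM.
  by move=> /val_inj.
exists (Condition FI fA adA Fside); split=> //= a ma.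
pose a' : maximal_node T := SigSub (mem_set ma).
by exists (set_val (F a')); split; [exists a'|exact: (FP a')].
Qed.

Lemma cond_leI Y SF Gamma (q p : condition Y SF Gamma) :
  end_extends (ctree q) (ctree p) -> cside p `<=` cside q ->
  (forall a v, labels p a v -> exists2 b, labels q b v & tle (ctree q) a b) ->
  cond_le q p.
Proof.
move=> ext sub lab; split=> // a.
have [|b [b' [<- e]] ab] := lab (set_val a) (set_val (cfun p a)); first by exists a.
by exists b'; split=> //; apply/val_inj.
Qed.

(** * The chain condition *)

(** A node can carry different labels in p and in q, so the common tree is extended by one new
    maximal node per label, and the sets of models are united. *)
Lemma amalgamation pi Y SF (Gamma : set V) (p q : condition Y SF Gamma)
    (b b' g : V) :
  setting pi Y SF -> Gamma `<=` Lambda SF -> stationary_omega2 Gamma ->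
  Gamma b -> Gamma b' -> b' ∈ b -> g ∈ b' ->
  node (ctree p) = node (ctree q) ->
  (forall x y, tlt (ctree p) x y <-> tlt (ctree q) x y) ->
  (forall a v, v ∈ g -> labels p a v <-> labels q a v) ->
  (forall N, cside q N -> exists2 N', cside p N' & vinter N g = vinter N' g) ->
  (forall M, cside p M -> ext M `<=` ext b) ->
  (forall a v, labels p a v -> v ∈ b) ->
  (forall N z, cside p N -> z ∈ N -> z ∈ b' -> z ∈ g) ->
  (forall N z, cside q N -> z ∈ N -> z ∈ b -> z ∈ g) ->
  (forall a v, labels q a v -> v ∈ b -> v ∈ g) ->
  exists r, cond_le r p /\ cond_le r q.
Proof.
move=> S GL st Gb Gb' b'b gb' nE tE lE refl pb lpb pgap qgap lqgap.
have mE a : maximal_node (ctree p) a <-> maximal_node (ctree q) a.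
  by rewrite /maximal_node /= nE; split=> -[? h]; split=> // x /tE; exact: h.
pose R a v := labels p a v \/ labels q a v.
have Rpq a v : labels q a v -> v ∈ b -> labels p a v.
  by move=> av vb; apply/(lE _ _ (lqgap _ _ av vb)).
have Rmax a v : R a v -> maximal_node (ctree p) a.
  by move=> [/labels_maximal|/labels_maximal/mE].
have Rtot a : maximal_node (ctree p) a -> exists v, R a v.
  by move=> /labels_total[v av]; exists v; left.
(* Labels of p are below b, and a label of q below b is a label of p at the same node, so the mixed
   cases reduce to injectivity in p. *)
have Rinj a c v : R a v -> R c v -> a = c.
  move=> [av|av] [cv|cv]; [exact: labels_inj av cv| | |exact: labels_inj av cv].
    exact: labels_inj av (Rpq _ _ cv (lpb _ _ av)).
  exact: labels_inj (Rpq _ _ av (lpb _ _ cv)) cv.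
have Rfin : finite_set [set v | exists a, R a v].
  have fU : finite_set ([set av | labels p av.1 av.2] `|` [set av | labels q av.1 av.2]).
    by rewrite finite_setU; split; exact: labels_finite.
  apply: sub_finite_set (finite_image snd fU) => v [a [av|av]]; exists (a, v) => //.
    by left.
  by right.
have [U [nu [ext_U Umax maxU ltU nuI]]] := graft_tree Rmax Rtot Rinj Rfin.
(* Models of p lie below b, where every label of q is also a label of p. *)
have lab_p M a v : cside p M -> v ∈ M -> R a v -> labels p a v.
  by move=> pM vM [//|av]; apply: Rpq av _; exact: pb vM.
(* A label of p is below b, so inside a model of q it is below g, where p and q have the same
   labels. *)
have lab_q M a v : cside q M -> v ∈ M -> R a v -> labels q a v.
  move=> qM vM [av|//]; have vg := qgap _ _ qM vM (lpb _ _ av).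
  exact/lE.
have tle_lt (c : condition Y SF Gamma) a d e : maximal_node (ctree c) a ->
    maximal_node (ctree c) d -> a <> d -> tle (ctree c) e a -> tle (ctree c) e d ->
    tlt (ctree c) e a /\ tlt (ctree c) e d.
  move=> [_ amax] [_ dmax] ad [ea|ea] [ed|ed]; subst=> //.
  - by case: (dmax _ ea).
  - by case: (amax _ ed).
have [|||||r [rT rA rlab]] := @condition_of_labels Y SF Gamma U
    (fun x v => exists a, R a v /\ x = nu v) (cside p `|` cside q).
- move=> _ /Umax[a [v [Rv ->]]]; exists v; split; last by exists a.
  by case: Rv => /labels_omega2.
- by move=> _ _ v [a [_ ->]] [c [_ ->]].
- by rewrite finite_setU; split; exact: cside_finite.
- apply: (adequate_setU S GL st (cside_adequate p) (cside_adequate q) Gb Gb' b'b gb').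
  + exact: pb.
  + exact: qgap.
  + exact: pgap.
  + exact: refl.
(* Both labels lie in M, so both belong to the condition that contributes M. They are distinct,
   hence so are the old nodes a and c, and clause (4) of that condition applies to them. *)
- move=> M x y v w d pqM xy [a [Rv ex]] [c [Rw ey]] vM wM; subst x y.
  rewrite (ltU _ _ _ Rv) (ltU _ _ _ Rw) => da dc.
  have vw : v <> w by move=> e; apply: xy; rewrite e.
  case: pqM => [pM|qM].
    have [lv lw] := (lab_p _ _ _ pM vM Rv, lab_p _ _ _ pM wM Rw).
    have ac : a <> c.
      by move=> e; apply: vw; rewrite e in lv; exact: labels_fun lv lw.
    have [] := tle_lt p a c d (labels_maximal lv) (labels_maximal lw) ac da dc.
    exact: labels_side pM ac lv lw vM wM.
  have [lv lw] := (lab_q _ _ _ qM vM Rv, lab_q _ _ _ qM wM Rw).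
  have ac : a <> c.
    by move=> e; apply: vw; rewrite e in lv; exact: labels_fun lv lw.
  have tleq x y : tle (ctree p) x y -> tle (ctree q) x y.
    by move=> [/tE|->]; [left|right].
  have [] := tle_lt q a c d (labels_maximal lv) (labels_maximal lw) ac
    (tleq _ _ da) (tleq _ _ dc).
  exact: labels_side qM ac lv lw vM wM.
have rlabR a v : R a v -> exists2 x, labels r x v & tle U a x.
  move=> Rv; have [w [lw [c [Rw e]]]] := rlab _ (maxU _ _ Rv).
  have vw := nuI _ _ _ _ Rv Rw e; rewrite -vw in lw.
  by exists (nu v) => //; left; apply/(ltU _ _ _ Rv); right.
have ext_Uq : end_extends U (ctree q).
  have [sub ex] := ext_U; split=> [x|x y]; rewrite -?nE; first exact: sub.
  by move=> Tx Ty; rewrite -tE; exact: ex.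
exists r; split; apply: cond_leI; rewrite ?rT ?rA //.
- by move=> a v av; apply: rlabR; left.
- by move=> a v av; apply: rlabR; right.
Qed.

Definition trace Y SF Gamma (g : V) (c : condition Y SF Gamma) :=
  (node (ctree c), [set xy | tlt (ctree c) xy.1 xy.2],
   [set av | labels c av.1 av.2 /\ av.2 ∈ g],
   (fun N => vinter N g) @` cside c).

(** Each component is a finite subset of a set of size at most omega1; for the models this set is
    given by thinness. *)
Lemma trace_le1 pi Y SF Gamma g : setting pi Y SF -> omega2 g ->
  range (@trace Y SF Gamma g) #<= omega1.
Proof.
move=> S og; have cg := og.2.
have c1 := le1_finite_subsets (card_lexx omega1).
have c2 := le1_finite_subsets le1_omega1X.
have c3 := le1_finite_subsets (le1X (card_lexx omega1) cg).
have c4 := le1_finite_subsets (Y_thin S og).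
apply: card_le_trans (le1X (le1X (le1X c1 c2) c3) c4).
apply: subset_card_le => _ [c _ <-].
have T1 := @tree_omega1 (ctree c); have Tf := tree_finite (ctree c).
split; first split; first split; split=> /=.
- exact: Tf.
- exact: T1.
- apply: sub_finite_set (finite_setX Tf Tf) => -[x y] /= /tree_node[Tx Ty]; exact.
- by move=> [x y] /= /tree_node[/T1 ? /T1].
- by apply: sub_finite_set (labels_finite c) => x [].
- by move=> [a v] /= [/labels_maximal[/T1]].
- exact: finite_image (cside_finite c).
- move=> _ [N cN <-]; exists N => //.
  by have [/(_ _ cN)[]] := cside_adequate c.
Qed.

(** For unboundedness, iterate ω times a choice of an ordinal above x and above all values of h
    below x, and take the supremum. *)
Lemma club_closure_points (h : V -> V) : (forall x, omega2 x -> omega2 (h x)) ->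
  club_omega2 [set b | omega2 b /\ forall x, x ∈ b -> h x ∈ b].
Proof.
move=> h2; split=> [b []//|a oa|b ob [_ lb]]; last first.
  split=> // x /lb[d [[od dh] db xd]].
  exact: (ord_trans (omega2_ord ob) (dh _ xd) db).
have /choice[k kP] (x : V) : exists y, omega2 x ->
    [/\ omega2 y, x ∈ y & forall z, z ∈ x -> h z ∈ y].
  have [ox|] := pselect (omega2 x); last by exists vempty.
  have [||y oy yP] := @omega2_bounded ([set x] `|` h @` ext x).
  - by move=> _ [->//|[z zx <-]]; apply: h2; exact: omega2_mem ox zx.
  - apply: le1U; first exact/countable_le1/countable1.
    exact: card_le_trans (card_image_le _ _) ox.2.
  exists y => _; split=> //; first by apply: yP; left.
  by move=> z zx; apply: yP; right; exists z.
pose s n := iter n k a.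
have os n : omega2 (s n) by elim: n => //= n IH; case: (kP _ IH).
have sX : range s `<=` omega2 by move=> _ [n _ <-].
have cX : range s #<= omega1.
  by apply: countable_le1; exact: card_le_trans (card_image_le _ _) _.
have [_ SE] := ord_osup (small_sub sX small_omega2) (fun x h => omega2_ord (sX x h)).
exists (osup (range s)); first split; first exact: omega2_osup.
  move=> x /SE[_ [n _ <-] xs]; apply/SE; exists (s n.+1); first by exists n.+1.
  by have [_ _] := kP _ (os n); exact.
apply/SE; exists (s 1); first by exists 1.
by have [] := kP _ oa.
Qed.

(** The trace t is realized by some p in A with a gap [g, b') in its models; d bounds p and b', so
    that witnesses can be controlled by ordinals. *)
Definition reflected Y SF Gamma (A : set (condition Y SF Gamma)) (g : V) t
    (d : V) : Prop :=
  exists b' (p : condition Y SF Gamma),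
  [/\ A p, Gamma b', g ∈ b' & trace g p = t] /\
  [/\ forall N z, cside p N -> z ∈ N -> z ∈ b' -> z ∈ g,
      b' ∈ d, forall M, cside p M -> ext M `<=` ext d &
      forall a v, labels p a v -> v ∈ d].

Lemma condition_bound pi Y SF Gamma (c : condition Y SF Gamma) b :
  setting pi Y SF -> omega2 b -> exists d, [/\ omega2 d, b ∈ d,
    forall M, cside c M -> ext M `<=` ext d &
    forall a v, labels c a v -> v ∈ d].
Proof.
move=> S ob; have YA M : cside c M -> Y M.
  by move=> cM; have [/(_ _ cM)[]] := cside_adequate c.
have [||d od dP] := @omega2_bounded
    ([set b] `|` \bigcup_(M in cside c) ext M `|`
     snd @` [set av | labels c av.1 av.2]).
- move=> x [[->//|[M /YA YM xM]]|[[a v] /= /labels_omega2 ov <-//]].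
  exact: (Y_ord S YM).
- apply: le1U; first apply: le1U.
  + exact/countable_le1/countable1.
  + apply: countable_le1; apply: bigcup_countable.
      exact/finite_set_countable/cside_finite.
    by move=> M /YA; exact: (Y_countable S).
  + exact/countable_le1/finite_set_countable/finite_image/labels_finite.
exists d; split=> //; first by apply: dP; left; left.
- by move=> M cM x xM; apply: dP; left; right; exists M.
- by move=> a v av; apply: dP; right; exists (a, v).
Qed.

(** Choose one bound d for each trace that has any; there are at most omega1 traces, so all these
    choices lie below one e < omega2. *)
Lemma reflection_bound pi Y SF Gamma (A : set (condition Y SF Gamma)) g :
  setting pi Y SF -> omega2 g ->
  exists2 e, omega2 e & forall t d, omega2 d -> reflected A g t d ->
    exists2 d', d' ∈ e & reflected A g t d'.
Proof.
move=> S og; pose P t d := omega2 d /\ reflected A g t d.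
have /choice[h hP] t : exists d, (exists d', P t d') -> P t d.
  have [[d Pd]|no] := pselect (exists d', P t d'); first by exists d.
  by exists vempty.
pose X := h @` [set t | range (@trace Y SF Gamma g) t /\ exists d, P t d].
have [||e oe eP] := @omega2_bounded X.
- by move=> _ [t [_ /hP[]] + _ <-].
- apply: card_le_trans (card_image_le _ _) _.
  by apply: card_le_trans (trace_le1 Gamma S og); apply: subset_card_le => t [].
exists e => // t d od td; have Pt : exists d, P t d by exists d.
have [_ ht] := hP t Pt; exists (h t) => //; apply: eP; exists t => //; split=> //.
by have [b' [p [[_ _ _ <-] _]]] := td; exists p.
Qed.

Theorem proposition7p10 (pi : V -> V) (Y : set V) (SF : fun_family)
    (Gamma : set V) :
  [set X : set V | X `<=` omega1] #= omega2 ->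
  set_bij omega2 H_omega2 pi ->
  stationary_P_omega1 Y ->
  thin Y ->
  closed_initial_segments Y ->
  definable_skolem_functions pi Y SF ->
  Gamma `<=` Lambda SF ->
  stationary_omega2 Gamma ->
  chain_condition (@cond_le Y SF Gamma) omega2.
Proof.
move=> _ pib [YP _] thY inY sk GL st A antiA.
have S : setting pi Y SF by [].
apply: card_lt_omega2.
have /choice[h hP] g : exists e, omega2 g -> omega2 e /\ forall t d, omega2 d ->
    reflected A g t d -> exists2 d', d' ∈ e & reflected A g t d'.
  have [/(reflection_bound A S)[e oe eP]|] := pselect (omega2 g); first by exists e.
  by exists vempty.
(* Stationarity puts a closure point b of h into Gamma. *)
have [|b [[ob bh] Gb]] := st.2 _ (@club_closure_points h _).
  by move=> x /hP[].
have Gord x : Gamma x -> ordinal x by move=> /st.1/omega2_ord.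
(* Reflecting q yields a member p of A that lies below b and is compatible with q; hence p = q. *)
have below q : A q -> (forall M, cside q M -> ext M `<=` ext b) /\
    (forall a v, labels q a v -> v ∈ b).
  move=> Aq; have [d0 [od0 b0 _ _]] := condition_bound q S ob.
  have YA M : cside q M -> Y M.
    by move=> cM; have [/(_ _ cM)[]] := cside_adequate q.
  (* The entries of q below b are countably many, so by cofinality omega1 some g < b bounds them. *)
  pose X := ((\bigcup_(M in cside q) ext M) `|`
     snd @` [set av | labels q av.1 av.2]) `&` ext b.
  have [||||g gb gP] := @cofinality_omega1_bound b X.
  - exact: omega2_ord.
  - by have [] := GL _ Gb.
  - by move=> x [].
  - apply: (@card_le_trans _ _ _ ((\bigcup_(M in cside q) ext M) `|`
      snd @` [set av | labels q av.1 av.2])).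
      by apply: subset_card_le => x [].
    rewrite -bigcup2E; apply: bigcup_countable => // -[|[|i]] _ //=.
      apply: bigcup_countable; first exact/finite_set_countable/cside_finite.
      by move=> M /YA; exact: (Y_countable S).
    exact/finite_set_countable/finite_image/labels_finite.
  have qgap N z : cside q N -> z ∈ N -> z ∈ b -> z ∈ g.
    by move=> qN zN zb; apply: gP; split=> //; left; exists N.
  have lqgap a v : labels q a v -> v ∈ b -> v ∈ g.
    by move=> av vb; apply: gP; split=> //; right; exists (a, v).
  have og := omega2_mem ob gb; have [_ hgP] := hP g og.
  have [d [od bd qd lqd]] := condition_bound q S ob.
  have [|d' d'h [b' [p [[Ap Gb' gb' tr] [pgap b'd' pd' lpd']]]]] :=
      hgP (trace g q) d od.
    (* The trace of q is reflected by q itself, with b in the role of b'. *)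
    by exists b, q.
  have d'b : d' ∈ b by exact: (ord_trans (omega2_ord ob) d'h (bh _ gb)).
  have b'b : b' ∈ b by exact: (ord_trans (omega2_ord ob) b'd' d'b).
  have pb M : cside p M -> ext M `<=` ext b.
    by move=> pM x /(pd' _ pM) xd'; exact: (ord_trans (omega2_ord ob) xd' d'b).
  have lpb a v : labels p a v -> v ∈ b.
    by move=> /lpd' vd'; exact: (ord_trans (omega2_ord ob) vd' d'b).
  have [<-//|pq] := pselect (p = q).
  case: (antiA p q Ap Aq pq); case: tr => nE tE lE sE.
  apply: (amalgamation S GL st Gb Gb' b'b gb' nE) => //.
  - move=> x y; have := congr1 (fun B : set (V * V) => B (x, y)) tE.
    by move=> /= ->.
  - move=> a v vg; have := congr1 (fun B : set (V * V) => B (a, v)) lE.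
    by move=> /= e; have [e1 e2] : (labels p a v /\ v ∈ g) <-> (labels q a v /\ v ∈ g);
      [rewrite e|split=> [l|l]; [case: (e1 (conj l vg))|case: (e2 (conj l vg))]].
  - move=> N qN; have : ((fun N => vinter N g) @` cside q) (vinter N g) by exists N.
    by rewrite -sE => -[N' pN' e]; exists N'.
apply: card_le_trans (trace_le1 Gamma S ob).
(* Members of A lie below b, so if p and q have the same trace at b, then p itself extends both, and
   the antichain forces p = q. *)
apply: (inj_card_leE (f := trace b)) => [q _|p q]; first by exists q.
move=> /set_mem Ap /set_mem Aq [nE tE lE sE]; apply: contrapT => pq.
have [[pb lpb] [qb lqb]] := (below p Ap, below q Aq).
have tE' x y : tlt (ctree p) x y <-> tlt (ctree q) x y.
  by have /= := congr1 (fun B : set (V * V) => B (x, y)) tE; move=> ->.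
have lE' a v : labels p a v <-> labels q a v.
  have /= e := congr1 (fun B : set (V * V) => B (a, v)) lE.
  have [e1 e2] : (labels p a v /\ v ∈ b) <-> (labels q a v /\ v ∈ b) by rewrite e.
  by split=> l; [case: (e1 (conj l (lpb _ _ l)))|case: (e2 (conj l (lqb _ _ l)))].
have vE (c : condition Y SF Gamma) : (forall M, cside c M -> ext M `<=` ext b) ->
    (fun N => vinter N b) @` cside c = cside c.
  move=> cb; have vM M : cside c M -> vinter M b = M.
    move=> /cb Mb; apply: ext_eq => z; rewrite in_vinter.
    by split=> [[]//|zM]; split=> //; exact: Mb.
  by apply/seteqP; split=> [_ [M cM <-]|M cM]; [rewrite vM|exists M => //; exact: vM].
rewrite !vE // in sE.
apply: (antiA p q Ap Aq pq); exists p; split; apply: cond_leI => //.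
- by split.
- by move=> a v av; exists a => //; right.
- by split=> [x|x y _ _]; [rewrite nE|exact: tE'].
- by rewrite sE.
- by move=> a v /lE' av; exists a => //; right.
Qed.
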